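(* Let $(X,\mu)$ be a measure space and let $A$ be a self-adjoint, negative semidefinite operator with compact resolvent on $L^2(X,\mu)$. Denote by $s(A)$ the spectral bound of $A$ and by $P$ the orthogonal projector of $L^2(X,\mu)$ onto the eigenspace $E_{s(A)}$ of $A$ associated with $s(A)$. Then the following assertions are equivalent: (i) $P$ is $\infty$-contractive; (ii) the semigroup $(\mathrm{e}^{tA})_{t\ge 0}$ is asymptotically $\infty$-contractive.
   Context: The spectral bound is $s(A)=\sup\{\operatorname{Re}\lambda:\lambda\in\sigma(A)\}$ (here the largest eigenvalue of $A$). Write $[-\mathbf 1,\mathbf 1]:=\{f\in L^2(X,\mu): |f|\le 1 \text{ a.e.}\}$. A bounded linear operator $T$ on $L^2(X,\mu)$ is called $\infty$-contractive if $|Tf|\le \mathbf 1$ a.e. for all $f\in L^2(X,\mu)$ with $|f|\le \mathbf 1$ a.e. The semigroup $(\mathrm{e}^{tA})_{t\ge 0}$ is called asymptotically $\infty$-contractive if $\mathrm{dist}(\mathrm{e}^{t(A-s(A))}f,[-\mathbf 1,\mathbf 1])\to 0$ as $t\to\infty$ for all $f\in L^2(X,\mu)$ with $|f|\le \mathbf 1$ a.e., where the distance is taken with respect to the norm of $L^2(X,\mu)$. *)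

(* Defs.v *)
From HB Require Import structures.
From mathcomp Require Import all_boot all_order all_algebra complex.
From mathcomp Require Import all_classical all_reals all_analysis measurable_realfun.

Set Implicit Arguments.
Unset Strict Implicit.
Unset Printing Implicit Defensive.
Import Order.TTheory GRing.Theory Num.Theory.
Import numFieldNormedType.Exports.
Import Normc.

Local Open Scope classical_set_scope.
Local Open Scope ring_scope.
Local Open Scope complex_scope.
Local Open Scope quotient_scope.

Section unbounded_operators.
Context (K : numFieldType) (H : normedModType K).

(* Only the values of [op A] on [dom A] are meaningful; two operators are the
   same when their graphs [op_graph] are. *)
Record unbounded_operator := UnboundedOperator {
  dom : set H ;
  op :> H -> H ;
  dom0 : dom 0 ;
  dom_linear : forall a x y, dom x -> dom y -> dom (a *: x + y) ;
  op_linear : forall a x y, dom x -> dom y -> op (a *: x + y) = a *: op x + op y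
}.

Implicit Type A : unbounded_operator.

Definition op_graph A : set (H * H) := [set p | dom A p.1 /\ A p.1 = p.2].

(* [S] is the everywhere defined bounded inverse of [lambda - A]. *)
Definition is_resolvent A (lambda : K) (S : {linear H -> H}) : Prop :=
  [/\ continuous S,
      forall y, dom A (S y) /\ lambda *: S y - A (S y) = y &
      forall x, dom A x -> S (lambda *: x - A x) = x].

Definition resolvent_set A : set K :=
  [set lambda | exists S, is_resolvent A lambda S].

Definition spectrum A : set K := ~` resolvent_set A.

Definition op_eigenspace A (lambda : K) : set H :=
  [set x | dom A x /\ A x = lambda *: x].

Definition compact_operator (S : H -> H) : Prop :=
  forall B : set H, bounded_set B -> precompact (S @` B).

Definition compact_resolvent A : Prop :=
  exists lambda S, is_resolvent A lambda S /\ compact_operator S.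

(* The scalar product [dot] is linear in its first argument. *)
Variable dot : H -> H -> K.

Definition adjoint_graph A : set (H * H) :=
  [set p | forall x, dom A x -> dot (A x) p.1 = dot x p.2].

Definition self_adjoint A : Prop :=
  dense (dom A) /\ op_graph A = adjoint_graph A.

Definition negative_semidefinite A : Prop :=
  forall x, dom A x -> dot (A x) x <= 0.

Definition orthogonal_projector (E : set H) (P : H -> H) : Prop :=
  forall x, E (P x) /\ forall y, E y -> dot (x - P x) y = 0.

End unbounded_operators.

Section semigroups.
Context (R : realType) (H : normedModType R[i]).

(* [sup] is real-valued: if [H] is trivial, the spectrum is empty and the value
   is 0. *)
Definition spectral_bound (A : unbounded_operator H) : R :=
  sup [set complex.Re lambda | lambda in spectrum A].

(* The values of [T] at negative times are irrelevant. *)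
Definition C0_semigroup (T : R -> {linear H -> H}) : Prop :=
  [/\ forall t, 0 <= t -> continuous (T t),
      forall x, T 0 x = x,
      forall s t, 0 <= s -> 0 <= t -> forall x, T (s + t) x = T s (T t x) &
      forall x, T t x @[t --> 0^'+] --> x].

Definition generator_graph (T : R -> {linear H -> H}) : set (H * H) :=
  [set p | (h^-1)%:C *: (T h p.1 - p.1) @[h --> 0^'+] --> p.2].

(* [T t] is $\mathrm e^{tA}$: the C_0-semigroup whose generator is [A]. *)
Definition exp_semigroup (A : unbounded_operator H)
    (T : R -> {linear H -> H}) : Prop :=
  C0_semigroup T /\ op_graph A = generator_graph T.

Definition dist_to (x : H) (S : set H) : R :=
  inf [set complex.Re `|x - y| | y in S].

End semigroups.

Section square_integrable.
Context d (X : measurableType d) (R : realType).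
Variable mu : {measure set X -> \bar R}.

Definition square_integrable (f : X -> R[i]) : Prop :=
  [/\ measurable_fun setT (fun x => complex.Re (f x)),
      measurable_fun setT (fun x => complex.Im (f x)) &
      finite_norm mu 2 (fun x => normc (f x))].

Definition sqint : {pred X -> R[i]} := mem [set f | square_integrable f].

Lemma sqintP (f : X -> R[i]) : reflect (square_integrable f) (f \in sqint).
Proof. by apply: (iffP idP) => [/set_mem|/mem_set]. Qed.

Lemma measurable_normc (f : X -> R[i]) :
  measurable_fun setT (fun x => complex.Re (f x)) ->
  measurable_fun setT (fun x => complex.Im (f x)) ->
  measurable_fun setT (fun x => normc (f x)).
Proof.
move=> mr mi.
have -> : (fun x => normc (f x)) = (@Num.sqrt R) \o
   (fun x => (complex.Re (f x)) ^+ 2 + (complex.Im (f x)) ^+ 2).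
  by apply/funext => x /=; case: (f x).
apply: measurableT_comp; first exact: (continuous_measurable_fun (@sqrt_continuous R)).
by apply: measurable_funD; exact: measurable_funX.
Qed.

Lemma le_Lnorm2 (f g : X -> R) :
  measurable_fun setT f -> measurable_fun setT g ->
  (forall x, `|f x| <= `|g x|) ->
  ('N[mu]_2[EFin \o f] <= 'N[mu]_2[EFin \o g])%E.
Proof.
move=> mf mg fg; rewrite unlock /Lnorm /=.
have mpow (h : X -> R) : measurable_fun setT h ->
    measurable_fun setT (fun x => (`|h x| `^ 2)%:E).
  move=> mh; apply/measurable_EFinP.
  apply: (@measurableT_comp _ _ _ _ _ _ (@powR R ^~ 2)) => //.
  exact: measurableT_comp.
have pow_ge0 (h : X -> R) : (0 <= \int[mu]_x (`|h x| `^ 2)%:E)%E.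
  by apply: integral_ge0 => x _; rewrite lee_fin powR_ge0.
apply: gt0_ler_poweR; first by rewrite invr_ge0.
- by rewrite in_itv/= leey andbT.
- by rewrite in_itv/= leey andbT.
apply: ge0_le_integral => //; [exact: mpow|exact: mpow|] => x _.
by rewrite lee_fin ge0_ler_powR ?nnegrE.
Qed.

Definition L2seminorm (f : X -> R[i]) : R :=
  fine 'N[mu]_2[EFin \o (fun x => normc (f x))].

Lemma normc_ge0 (z : R[i]) : 0 <= normc z.
Proof. by case: z => a b; exact: sqrtr_ge0. Qed.

Lemma L2seminormE f : square_integrable f ->
  (L2seminorm f)%:E = 'N[mu]_2[EFin \o (fun x => normc (f x))]%E.
Proof.
move=> [_ _ ff]; rewrite /L2seminorm fineK// ge0_fin_numE ?Lnorm_ge0//.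
Qed.

Lemma Lnorm_normcD (f g : X -> R[i]) : square_integrable f -> square_integrable g ->
  measurable_fun setT (fun x => normc (f x + g x)) ->
  ('N[mu]_2[EFin \o (fun x => normc (f x + g x)%R)] <=
   'N[mu]_2[EFin \o (fun x => normc (f x))] +
   'N[mu]_2[EFin \o (fun x => normc (g x))])%E.
Proof.
move=> [fr fi ff] [gr gi gf] mfg.
have mf := measurable_normc fr fi; have mg := measurable_normc gr gi.
apply: le_trans (eminkowski mu mf mg _); last by rewrite lee1n.
apply: le_Lnorm2 => //; first exact: measurable_funD.
move=> x; rewrite !ger0_norm ?addr_ge0 ?normc_ge0//.
exact: le_normcD.
Qed.

Lemma Lnorm_normcZ (a : R[i]) (f : X -> R[i]) : measurable_fun setT (fun x => normc (f x)) ->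
  ('N[mu]_2[EFin \o (fun x => normc (a * f x)%R)] =
   (normc a)%:E * 'N[mu]_2[EFin \o (fun x => normc (f x))])%E.
Proof.
move=> mf.
rewrite unlock /Lnorm.
under eq_integral do
  rewrite /= normcM normrM (ger0_norm (normc_ge0 a)) powRM ?normc_ge0// EFinM.
rewrite ge0_integralZl//; last 2 first.
- apply/measurable_EFinP; apply: (@measurableT_comp _ _ _ _ _ _ (@powR R ^~ 2)) => //.
  exact: measurableT_comp.
- by rewrite lee_fin powR_ge0.
rewrite poweRM ?integral_ge0 ?lee_fin ?powR_ge0//.
by rewrite poweR_EFin -powRrM mulfV// powRr1// normc_ge0.
Qed.

Lemma sqint_submod_closed : submod_closed sqint.
Proof.
have sZ (a : R[i]) (f : X -> R[i]) : square_integrable f -> square_integrable (a *: f).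
  move=> [fr fi ff]; have mf := measurable_normc fr fi; split.
  - rewrite (_ : (fun _ => _) = fun x => complex.Re a * complex.Re (f x)
       - complex.Im a * complex.Im (f x)).
      by apply: measurable_funB; exact: measurable_funM.
    by apply/funext => x; rewrite /GRing.scale /=; case: a (f x) => ? ? [? ?].
  - rewrite (_ : (fun _ => _) = fun x => complex.Re a * complex.Im (f x)
       + complex.Im a * complex.Re (f x)).
      by apply: measurable_funD; exact: measurable_funM.
    by apply/funext => x; rewrite /GRing.scale /=; case: a (f x) => ? ? [? ?].
  - rewrite /finite_norm (Lnorm_normcZ a mf) lte_mul_pinfty// lee_fin normc_ge0//.
have sD (f g : X -> R[i]) : square_integrable f -> square_integrable g -> square_integrable (f + g).
  move=> [fr fi ff] [gr gi gf].
  have mr : measurable_fun setT (fun x => complex.Re ((f + g) x)).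
    rewrite (_ : (fun _ => _) = fun x => complex.Re (f x) + complex.Re (g x)).
      exact: measurable_funD.
    by apply/funext => x /=; rewrite [(f + g) x]/(f x + g x); case: (f x) (g x) => ? ? [].
  have mi : measurable_fun setT (fun x => complex.Im ((f + g) x)).
    rewrite (_ : (fun _ => _) = fun x => complex.Im (f x) + complex.Im (g x)).
      exact: measurable_funD.
    by apply/funext => x /=; rewrite [(f + g) x]/(f x + g x); case: (f x) (g x) => ? ? [].
  split=> //; rewrite /finite_norm.
  have := measurable_normc mr mi => mn.
  apply: le_lt_trans (Lnorm_normcD _ _ mn) _; [by split|by split|].
  by rewrite lte_add_pinfty.
split=> [|a f g /sqintP sf /sqintP sg]; apply/sqintP; last exact: sD (sZ _ _ sf) sg.
split; [exact: measurable_cst|exact: measurable_cst|].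
rewrite /finite_norm (_ : _ \o _ = cst 0%E) ?Lnorm0//.
by apply/funext => x; congr EFin; exact: normc0.
Qed.

HB.instance Definition _ := GRing.isSubmodClosed.Build _ _ sqint
  sqint_submod_closed.

Definition sqint_fun : Type := {f : X -> R[i] | f \in sqint}.
HB.instance Definition _ := SubChoice.on sqint_fun.
HB.instance Definition _ := [SubChoice_isSubLmodule of sqint_fun by <:].

Lemma sqint_funP (f : sqint_fun) : square_integrable (\val f).
Proof. exact/sqintP/(valP f). Qed.

Definition ae_eq_fun (f g : sqint_fun) :=
  `[< {ae mu, forall x, \val f x = \val g x} >].

Lemma ae_eq_fun_refl : reflexive ae_eq_fun.
Proof. by move=> f; apply/asboolP/nearW. Qed.

Lemma ae_eq_fun_sym : symmetric ae_eq_fun.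
Proof. by move=> f g; apply/asboolP/asboolP; apply: filterS => x /esym. Qed.

Lemma ae_eq_fun_trans : transitive ae_eq_fun.
Proof.
move=> f g h /asboolP gf /asboolP fh; apply/asboolP.
by apply: filterS2 gf fh => x -> ->.
Qed.

Canonical ae_eq_fun_equiv :=
  EquivRel ae_eq_fun ae_eq_fun_refl ae_eq_fun_sym ae_eq_fun_trans.

Definition L2 : Type := {eq_quot ae_eq_fun}.
HB.instance Definition _ := Choice.on L2.
HB.instance Definition _ := EqQuotient.on L2.

Definition L2_fun (f : L2) : X -> R[i] := \val (repr f).

Lemma L2_eqP (f g : sqint_fun) :
  \pi_L2 f = \pi_L2 g <-> {ae mu, forall x, \val f x = \val g x}.
Proof.
by split=> [/eqmodP/asboolP|fg]; last by apply/eqmodP/asboolP.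
Qed.

Lemma L2_fun_pi (f : sqint_fun) :
  {ae mu, forall x, L2_fun (\pi_L2 f) x = \val f x}.
Proof. by apply/L2_eqP; rewrite reprK. Qed.

Definition L2_zero : L2 := \pi_L2 0.
Definition L2_opp (f : L2) : L2 := \pi_L2 (- repr f).
Definition L2_add (f g : L2) : L2 := \pi_L2 (repr f + repr g).
Definition L2_scale (a : R[i]) (f : L2) : L2 := \pi_L2 (a *: repr f).

Lemma L2_opp_pi (f : sqint_fun) : L2_opp (\pi_L2 f) = \pi_L2 (- f).
Proof.
apply/L2_eqP; have := L2_fun_pi f; apply: filterS => x fx.
rewrite !raddfN; exact: (congr1 (fun z => - z) fx).
Qed.

Lemma L2_add_pi (f g : sqint_fun) : L2_add (\pi_L2 f) (\pi_L2 g) = \pi_L2 (f + g).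
Proof.
apply/L2_eqP; have := L2_fun_pi f; have := L2_fun_pi g.
apply: filterS2 => x gx fx; rewrite !raddfD.
exact: (congr2 (fun y z => y + z) fx gx).
Qed.

Lemma L2_scale_pi a (f : sqint_fun) : L2_scale a (\pi_L2 f) = \pi_L2 (a *: f).
Proof.
apply/L2_eqP; have := L2_fun_pi f; apply: filterS => x fx.
rewrite !linearZ; exact: (congr1 (fun z => a * z) fx).
Qed.

Lemma L2_addA : associative L2_add.
Proof.
elim/quotW => f; elim/quotW => g; elim/quotW => h.
by rewrite (L2_add_pi g h) (L2_add_pi f g) !L2_add_pi addrA.
Qed.

Lemma L2_addC : commutative L2_add.
Proof. by elim/quotW => f; elim/quotW => g; rewrite (L2_add_pi f g) (L2_add_pi g f) addrC. Qed.

Lemma L2_add0 : left_id L2_zero L2_add.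
Proof. by elim/quotW => f; rewrite L2_add_pi add0r. Qed.

Lemma L2_addN : left_inverse L2_zero L2_opp L2_add.
Proof. by elim/quotW => f; rewrite L2_opp_pi L2_add_pi addNr. Qed.

HB.instance Definition _ := GRing.isZmodule.Build L2 L2_addA L2_addC L2_add0 L2_addN.

Lemma L2_scaleA a b (v : L2) : L2_scale a (L2_scale b v) = L2_scale (a * b) v.
Proof. by elim/quotW: v => f; rewrite (L2_scale_pi b f) !L2_scale_pi scalerA. Qed.

Lemma L2_scale1 : left_id 1 L2_scale.
Proof. by elim/quotW => f; rewrite L2_scale_pi scale1r. Qed.

Lemma L2_pi0 : 0 = \pi_L2 0. Proof. by []. Qed.

Lemma L2_piD (f g : sqint_fun) : \pi_L2 (f + g) = \pi_L2 f + \pi_L2 g.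
Proof. by rewrite -L2_add_pi. Qed.

Lemma L2_piN (f : sqint_fun) : \pi_L2 (- f) = - \pi_L2 f.
Proof. by rewrite -L2_opp_pi. Qed.

Lemma L2_scaleDr : right_distributive L2_scale +%R.
Proof.
move=> a; elim/quotW => f; elim/quotW => g.
by rewrite -(L2_piD f g) (L2_scale_pi a f) (L2_scale_pi a g) L2_scale_pi scalerDr L2_piD.
Qed.

Lemma L2_scaleDl v : {morph L2_scale^~ v : a b / a + b}.
Proof.
elim/quotW: v => f a b.
by rewrite (L2_scale_pi a f) (L2_scale_pi b f) L2_scale_pi scalerDl L2_piD.
Qed.

HB.instance Definition _ :=
  GRing.Zmodule_isLmodule.Build R[i] L2 L2_scaleA L2_scale1 L2_scaleDr L2_scaleDl.

Lemma L2_piZ a (f : sqint_fun) : \pi_L2 (a *: f) = a *: \pi_L2 f.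
Proof. by rewrite -L2_scale_pi. Qed.

Definition L2_norm (f : L2) : R := L2seminorm (L2_fun f).

Lemma eq_Lnorm_ae (f g : X -> R[i]) :
  square_integrable f -> square_integrable g ->
  {ae mu, forall x, f x = g x} ->
  ('N[mu]_2[EFin \o (fun x => normc (f x))] =
   'N[mu]_2[EFin \o (fun x => normc (g x))])%E.
Proof.
move=> [fr fi _] [gr gi _] fg; rewrite unlock /Lnorm /=; congr poweR.
have mpow (h : X -> R[i]) : measurable_fun setT (fun x => complex.Re (h x)) ->
    measurable_fun setT (fun x => complex.Im (h x)) ->
    measurable_fun setT (fun x => (`|normc (h x)| `^ 2)%:E).
  move=> hr hi; apply/measurable_EFinP.
  apply: (@measurableT_comp _ _ _ _ _ _ (@powR R ^~ 2)) => //.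
  by apply: measurableT_comp => //; exact: measurable_normc.
apply: ge0_ae_eq_integral => //; [exact: mpow|exact: mpow|].
by apply: filterS fg => x /= -> _.
Qed.

Lemma L2_norm_pi (f : sqint_fun) : L2_norm (\pi_L2 f) = L2seminorm (\val f).
Proof.
congr fine; apply: eq_Lnorm_ae; [exact: sqint_funP|exact: sqint_funP|].
exact: L2_fun_pi.
Qed.

Lemma L2_ler_normD (f g : L2) : (L2_norm (f + g))%:C <= (L2_norm f)%:C + (L2_norm g)%:C.
Proof.
elim/quotW: f => f; elim/quotW: g => g; rewrite -L2_piD !L2_norm_pi.
rewrite -rmorphD lecR -lee_fin EFinD !L2seminormE; [|exact: sqint_funP..].
apply: Lnorm_normcD; [exact: sqint_funP|exact: sqint_funP|].
by have [fr fi _] := sqint_funP (f + g); exact: measurable_normc.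
Qed.

Lemma L2_normrZ (a : R[i]) (f : L2) : (L2_norm (a *: f))%:C = `|a| * (L2_norm f)%:C.
Proof.
elim/quotW: f => f; rewrite -L2_piZ !L2_norm_pi.
rewrite -[`|a|]/(normc a)%:C -rmorphM; congr (_%:C).
apply: EFin_inj; rewrite EFinM !L2seminormE; [|exact: sqint_funP..].
by apply: Lnorm_normcZ; have [fr fi _] := sqint_funP f; exact: measurable_normc.
Qed.

Lemma L2_normr0_eq0 (f : L2) : (L2_norm f)%:C = 0 -> f = 0.
Proof.
elim/quotW: f => f; rewrite L2_norm_pi => -[N0].
have [fr fi _] := sqint_funP f.
have mf : measurable_fun setT (EFin \o (fun x => normc (\val f x))).
  exact/measurable_EFinP/measurable_normc.
rewrite L2_pi0; apply/L2_eqP.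
apply: filterS (Lnorm_eq0_eq0 (mu := mu) (p := 2) mf _ _) => [x /(_ I) [] /eq0_normc //||].
- by rewrite lte0n.
- by rewrite -L2seminormE ?N0//; exact: sqint_funP.
Qed.

HB.instance Definition _ :=
  Lmodule_isNormed.Build R[i] L2 L2_ler_normD L2_normrZ L2_normr0_eq0.

Definition L2_dot (f g : L2) : R[i] :=
  (\int[mu]_x complex.Re (L2_fun f x * (L2_fun g x)^*)) +i*
  (\int[mu]_x complex.Im (L2_fun f x * (L2_fun g x)^*)).

Lemma L2_normE (f : L2) : `|f| = (L2_norm f)%:C. Proof. by []. Qed.

Lemma L2_dot_norm (f : L2) : L2_dot f f = `|f| ^+ 2.
Proof.
have [_ _ ff] := sqint_funP (repr f).
have EI : ((L2_norm f) ^+ 2)%:E = (\int[mu]_x ((normc (L2_fun f x)) ^+ 2)%:E)%E.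
  rewrite -(@powR_mulrn _ _ 2) ?fine_ge0 ?Lnorm_ge0// -poweR_EFin.
  rewrite L2seminormE; last exact: sqint_funP.
  rewrite poweR_Lnorm//; apply: eq_integral => x _ /=.
  by rewrite -powR_mulrn ?normc_ge0// ger0_norm ?normc_ge0.
have Re_sq (z : R[i]) : complex.Re (z * z^*) = normc z ^+ 2.
  by case: z => a b /=; rewrite sqr_sqrtr ?addr_ge0 ?sqr_ge0// mulrN opprK -!expr2.
have Im_sq (z : R[i]) : complex.Im (z * z^*) = 0.
  by case: z => a b /=; rewrite mulrN mulrC addNr.
rewrite L2_normE -rmorphXn /L2_dot /Rintegral.
under eq_integral do rewrite Re_sq.
under [X in _ +i* fine X]eq_integral do rewrite Im_sq.
by rewrite integral0 -EI.
Qed.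

(* The order interval $[-\mathbf 1, \mathbf 1]$ of $L^2(X,\mu)$. *)
Definition L2_unit_interval : set L2 :=
  [set f | {ae mu, forall x, `|L2_fun f x| <= 1}].

Definition infty_contractive (T : L2 -> L2) : Prop :=
  forall f, L2_unit_interval f -> L2_unit_interval (T f).

(* $\mathrm e^{t(A-s(A))}$ is $\mathrm e^{-ts(A)}\mathrm e^{tA}$. *)
Definition asymptotically_infty_contractive (A : unbounded_operator L2)
    (T : R -> {linear L2 -> L2}) : Prop :=
  forall f, L2_unit_interval f ->
    dist_to ((expR (- (t * spectral_bound A)))%:C *: T t f) L2_unit_interval
      @[t --> +oo] --> (0 : R).

End square_integrable.

(* Main.v *)
Require Import Defs.
From mathcomp Require Import all_boot all_order all_algebra complex.
From mathcomp Require Import all_classical all_reals all_analysis.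
From mathcomp Require Import measurable_realfun ring lra.
Import Order.TTheory GRing.Theory Num.Theory.
Import numFieldNormedType.Exports.
Import Normc.

(** Write $s$ for the spectral bound and $V_t = e^{-ts} e^{tA}$, a semigroup with
   generator $B = A - s$.  The whole equivalence rests on one fact: $V_t f$
   converges to $P f$ for every $f$ (exp_semigroup_cvg_projector).  Indeed, the
   distance of $V_t f$ to $[-1,1]$ is at most $|V_t f - P f|$ if $P f$ lies in
   $[-1,1]$, which gives (ii) from (i); conversely, if that distance tends to 0
   then $P f$ has distance 0 to $[-1,1]$, and the order interval is closed
   (L2_unit_interval_closed).

   The convergence is obtained by differentiating along orbits.
   - Let $m$ be the supremum of the numerical range of $A$.  If $m$ were in the
     resolvent set, boundedness of the resolvent would push the numerical range
     strictly below $m$ (resolvent_numerical_gap); so $m$ is in the spectrum,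
     $m \le s$, and $B$ is symmetric and negative semidefinite
     (numerical_range_le_spectral_bound).
   - Hence $V_t$ is contractive (dissipative_contraction) and symmetric
     (symmetric_semigroup).
   - By symmetry $|V_t f - V_r f|^2 = \phi(2t) + \phi(2r) - 2\phi(t+r)$ with
     $\phi(t) = (V_t f, f) = |V_{t/2} f|^2$, and by contractivity $\phi$ is
     nonincreasing.  So $V_t f$ is Cauchy (orbit_cauchy); its limit is fixed by
     the semigroup, hence lies in $\ker B$, and $f$ minus the limit is orthogonal
     to $\ker B$ (orbit_converges).  The limit is therefore $P f$.

   Orbits come with right derivatives only, so a right derivative bound must be
   integrated with the help of some continuity from the left
   (dini_nonincreasing).  That continuity follows from a bound on $|V_t|$ near
   $t = 0$, which is a uniform boundedness argument (C0_bounded_near0) and uses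
   that $L^2(X,\mu)$ is complete (L2_complete).

   The abstract part works in a complete complex inner product space through its
   real norm [rnorm] and the real part [rdot] of its scalar product, so that all
   estimates are inequalities between real numbers. *)

Set Implicit Arguments.
Unset Strict Implicit.
Unset Printing Implicit Defensive.

Local Open Scope classical_set_scope.
Local Open Scope ring_scope.
Local Open Scope complex_scope.
Local Open Scope quotient_scope.

(** * Real analysis *)

Section real_calculus.
Context (R : realType).

(** A right derivative bound alone does not make [f] nonincreasing (a step function
   has right derivative 0), so the first hypothesis forbids upward jumps from the
   left.  It is a one-sided condition, checked for squared norms and for scalar
   products of orbits by plain estimates.  The proof follows the supremum of the
   times up to which [f r <= f 0 + e * r]. *)
Lemma dini_nonincreasing (f : R -> R) (b : R) : 0 <= b ->
  (forall t e, 0 < t <= b -> 0 < e ->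
    exists2 d, 0 < d & forall h, 0 < h < d -> h <= t -> f t <= f (t - h) + e) ->
  (forall t e, 0 <= t < b -> 0 < e ->
    exists2 d, 0 < d & forall h, 0 < h < d -> t + h <= b ->
      f (t + h) <= f t + e * h) ->
  f b <= f 0.
Proof.
move=> b0 fl fr.
apply/ler_addgt0Pr => e' e'0.
(* The slope [e] is chosen so that [e * b <= e']; adding 1 covers [b = 0]. *)
pose e := e' / (b + 1).
have e0 : 0 < e by rewrite divr_gt0// ltr_pwDr.
have eb : e * b <= e'.
  rewrite /e mulrAC ler_pdivrMr; last by rewrite ltr_pwDr.
  by rewrite ler_pM2l// lerDl.
suff : f b <= f 0 + e * b by move=> /le_trans -> //; rewrite lerD2l.
pose S := [set t | 0 <= t <= b /\ forall r, 0 <= r <= t -> f r <= f 0 + e * r].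
have S0 : S 0.
  split; first by rewrite lexx.
  by move=> r; rewrite -eq_le => /eqP <-; rewrite mulr0 addr0.
have hS : has_sup S by split; [exists 0|exists b => t [/andP[]]].
pose t := sup S.
have t0 : 0 <= t by apply: ub_le_sup => //; case: hS.
have tb : t <= b by apply: ge_sup => // [|r [/andP[]]//]; exists 0.
have St : S t.
  split; first by rewrite t0.
  have below r : 0 <= r < t -> f r <= f 0 + e * r.
    move=> /andP[r0 rt]; have [|u [_ uS] tu] := @sup_adherent _ S (t - r) _ hS.
      by rewrite subr_gt0.
    apply: uS; rewrite r0 /=; move: tu; rewrite -/t; lra.
  move=> r /andP[r0]; rewrite le_eqVlt => /orP[/eqP ->|rt]; last first.
    by apply: below; rewrite r0.
  have [->|tn0] := eqVneq t 0; first by rewrite mulr0 addr0.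
  have tp : 0 < t by rewrite lt_def tn0.
  apply/ler_addgt0Pr => e1 e10; have [|//|dl dl0 Hl] := fl t e1 _.
    by rewrite tp.
  pose h := Num.min (dl / 2) t.
  have h0 : 0 < h by rewrite lt_min tp andbT divr_gt0.
  have ht : h <= t by rewrite ge_min lexx orbT.
  have hd : h < dl by rewrite gt_min; apply/orP; left; lra.
  have := Hl h; rewrite h0 hd => /(_ isT ht) /le_trans -> //.
  rewrite lerD2r; have /le_trans -> // : f (t - h) <= f 0 + e * (t - h).
    by apply: below; rewrite subr_ge0 ht /=; lra.
  by rewrite lerD2l ler_pM2l//; lra.
move: tb; rewrite le_eqVlt => /orP[/eqP <-|tb].
  by apply: St.2; rewrite t0 lexx.
exfalso; have [|//|dr dr0 Hr] := fr t e _; first by rewrite t0.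
pose h := Num.min (dr / 2) (b - t).
have h0 : 0 < h by rewrite lt_min subr_gt0 tb andbT divr_gt0.
have hb : t + h <= b by rewrite addrC -lerBrDr ge_min lexx orbT.
have hd : h < dr by rewrite gt_min; apply/orP; left; lra.
suff : S (t + h) by move=> /(ub_le_sup (proj2 hS)); rewrite -/t; lra.
split; first by rewrite hb andbT; lra.
move=> r /andP[r0 rth]; have [rt|rt] := leP r t; first by apply: St.2; rewrite r0.
have := Hr (r - t); rewrite subr_gt0 rt (addrC t) subrK.
have -> : r - t < dr by lra.
move=> /(_ isT) /(_ (le_trans rth hb)) /le_trans -> //.
have : f t <= f 0 + e * t by apply: St.2; rewrite t0 lexx.
lra.
Qed.

Lemma expR_sub1Dx_le (x : R) : `|x| <= 2^-1 -> `|expR x - 1 - x| <= 2 * x ^+ 2.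
Proof.
move=> /ler_normlP[x1 x2].
have l1 := expR_ge1Dx x.
have l2 : expR x * (1 - x) <= 1.
  rewrite -[leRHS](expRxMexpNx_1 x) ler_pM2l ?expR_gt0//.
  exact: expR_ge1Dx.
have x20 := sqr_ge0 x.
rewrite ger0_norm; last by lra.
have h : 0 < 1 - x by lra.
rewrite -(ler_pM2r h); nra.
Qed.

End real_calculus.

Lemma exists_natr_gt (R : realType) (x : R) : exists n : nat, x < n.+1%:R.
Proof.
exists (Num.bound `|x|); rewrite -natr1; apply: le_lt_trans (ler_norm x) _.
by apply: lt_trans (archi_boundP (normr_ge0 x)) _; rewrite ltrDl.
Qed.

(** Both estimates feed the product rule for [expR (h * a)] times an orbit; the
   quantitative form avoids quotients. *)
Lemma expR_linear_approx (R : realType) (a e : R) : 0 < e ->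
  exists2 d, 0 < d & forall h, 0 < h < d ->
    `|expR (h * a) - 1 - h * a| <= e * h /\ `|expR (h * a) - 1| <= e.
Proof.
move=> e0; have na := normr_ge0 a.
pose K := 2 * `|a| ^+ 2 + 1.
have K0 : 0 < K by rewrite /K; have := sqr_ge0 `|a|; lra.
pose d1 := (2 * (`|a| + 1))^-1.
have d10 : 0 < d1 by rewrite invr_gt0; lra.
have e10 : 0 < e / (e + `|a|) by rewrite divr_gt0//; lra.
exists (Num.min d1 (Num.min (e / K) (e / (e + `|a|)))).
  by rewrite !lt_min d10 divr_gt0.
move=> h /andP[h0]; rewrite !lt_min => /and3P[h1 h2 h3].
have ha : `|h * a| = h * `|a| by rewrite normrM gtr0_norm.
have small : `|h * a| <= 2^-1.
  have : d1 * (2 * (`|a| + 1)) = 1 by rewrite mulVf// gt_eqF//; lra.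
  rewrite ha; nra.
have b := expR_sub1Dx_le small.
have {b} b : `|expR (h * a) - 1 - h * a| <= e * h.
  apply: (le_trans b); rewrite exprMn -(real_normK (num_real a)).
  have : h * K <= e by rewrite -ler_pdivlMr// ltW.
  rewrite /K; nra.
split=> //.
have -> : expR (h * a) - 1 = (expR (h * a) - 1 - h * a) + h * a by rewrite subrK.
apply: le_trans (ler_normD _ _) _; rewrite ha.
have : h * (e + `|a|) <= e by rewrite -ler_pdivlMr ?ltW//; lra.
lra.
Qed.

(** * Complex inner product spaces over the reals *)

Section inner_product_space.
Context (R : realType) (H : normedModType R[i]).

(** The norm of [H] takes values in [R[i]], where the order is partial; its real part
   carries the same information (rnormE) and can be used with real arithmetic. *)
Definition rnorm (x : H) : R := complex.Re `|x|.

Lemma rnormE x : `|x| = (rnorm x)%:C.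
Proof.
rewrite /rnorm; have := normr_ge0 x; case: `|x| => a b.
by rewrite lecE /= => /andP[/eqP -> _].
Qed.

Lemma rnorm_ge0 x : 0 <= rnorm x.
Proof. by rewrite -lecR -rnormE normr_ge0. Qed.

Lemma rnorm0 : rnorm 0 = 0.
Proof. by rewrite /rnorm normr0. Qed.

Lemma rnorm0_eq0 x : rnorm x = 0 -> x = 0.
Proof. by move=> x0; apply: normr0_eq0; rewrite rnormE x0. Qed.

Lemma rnormN x : rnorm (- x) = rnorm x.
Proof. by rewrite /rnorm normrN. Qed.

Lemma rnormBC x y : rnorm (x - y) = rnorm (y - x).
Proof. by rewrite /rnorm distrC. Qed.

Lemma rnormD x y : rnorm (x + y) <= rnorm x + rnorm y.
Proof. by rewrite -lecR rmorphD /= -!rnormE ler_normD. Qed.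

Lemma rnorm_sub_trans z x y : rnorm (x - y) <= rnorm (x - z) + rnorm (z - y).
Proof. by apply: le_trans (rnormD _ _); rewrite addrA subrK. Qed.

Lemma rnorm_le_sub x y : rnorm x <= rnorm y + rnorm (x - y).
Proof. by rewrite -[X in rnorm X <= _](subrK y x) addrC; exact: rnormD. Qed.

Lemma rnormZ (a : R) x : rnorm (a%:C *: x) = `|a| * rnorm x.
Proof.
apply: (@complexI R); rewrite -rnormE normrZ normc_def /= expr0n addr0 sqrtr_sqr.
by rewrite rnormE rmorphM.
Qed.

Lemma cvg_rnormP (T : Type) (F : set_system T) (FF : Filter F) (u : T -> H) (l : H) :
  u @ F --> l <-> forall e : R, 0 < e -> \forall t \near F, rnorm (u t - l) < e.
Proof.
split=> [/cvgrPdist_lt ul e e0|ul].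
  have /ul : 0 < e%:C by rewrite ltcR.
  by apply: filterS => t; rewrite rnormE ltcR rnormBC.
apply/cvgrPdist_lt => -[a b]; rewrite ltcE/= => /andP[/eqP -> a0].
by have := ul _ a0; apply: filterS => t; rewrite rnormE -ltcR rnormBC.
Qed.

Lemma at_right0P (P : R -> Prop) :
  (\forall h \near 0^'+, P h) <->
  exists2 d, 0 < d & forall h, 0 < h < d -> P h.
Proof.
split=> [[d /= d0 dP]|[d d0 dP]]; exists d => //= h.
  by move=> /andP[h0 hd]; apply: dP => //=; rewrite sub0r normrN gtr0_norm.
rewrite /= sub0r normrN => hd h0; apply: dP; rewrite h0 /=.
by rewrite (le_lt_trans (ler_norm _) hd).
Qed.

Lemma continuous_linear_rnorm (S : {linear H -> H}) : continuous S ->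
  exists2 C, 0 < C & forall x, rnorm (S x) <= C * rnorm x.
Proof.
move=> cS; have /cvg_rnormP/(_ 1 ltr01) := cS 0.
move=> /nbhs_ballP[[d di] /=]; rewrite ltcE /= => /andP[/eqP -> d0] dS.
exists (2 / d); first by rewrite divr_gt0.
move=> x; have [->|x0] := eqVneq x 0; first by rewrite linear0 rnorm0 mulr0.
have nx : 0 < rnorm x.
  by rewrite lt_def rnorm_ge0 andbT; apply: contra_neq x0; exact: rnorm0_eq0.
have := dS ((d / 2 / rnorm x)%:C *: x).
rewrite linear0 !subr0 /= -ball_normE /= sub0r normrN rnormE rnormZ linearZ /= rnormZ.
rewrite ltcR gtr0_norm; last by rewrite !divr_gt0.
rewrite divfK ?gt_eqF// => /(_ _)/ltW dx.
have {dx} : d / 2 / rnorm x * rnorm (S x) <= 1 by apply: dx; lra.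
rewrite -mulrA (mulrC (_^-1)) mulrA ler_pdivrMr// mul1r => h.
rewrite mulrAC ler_pdivlMr//; lra.
Qed.

(** Only symmetry, linearity and compatibility with the norm are recorded:
   definiteness follows from that of the norm. *)
Record inner_product (dot : H -> H -> R[i]) : Prop := InnerProduct {
  dot_linearl : forall a x y z, dot (a *: x + y) z = a * dot x z + dot y z ;
  dot_conj : forall x y, dot y x = (dot x y)^* ;
  dot_norm : forall x, dot x x = `|x| ^+ 2 }.

Context (dot : H -> H -> R[i]) (ip : inner_product dot).

(** This is the scalar product of the underlying real space.  It has the same norm,
   so contractivity, Cauchy sequences and limits can be handled with it, and it
   turns a conjugate symmetric form into a symmetric one. *)
Definition rdot x y := complex.Re (dot x y).

Lemma rdotC x y : rdot x y = rdot y x.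
Proof. by rewrite /rdot (dot_conj ip y x); case: (dot y x). Qed.

Lemma rdotDl x y z : rdot (x + y) z = rdot x z + rdot y z.
Proof.
rewrite /rdot -{1}(scale1r x) (dot_linearl ip) mul1r.
by case: (dot x z) (dot y z) => ? ? [].
Qed.

Lemma rdotZl (a : R) x y : rdot (a%:C *: x) y = a * rdot x y.
Proof.
have d0 z : dot 0 z = 0.
  have := dot_linearl ip 1 0 0 z; rewrite scale1r addr0 mul1r => /eqP.
  by rewrite -subr_eq subrr => /eqP <-.
rewrite /rdot -{1}(addr0 (_ *: x)) (dot_linearl ip) d0 addr0.
by case: (dot x y) => ? ? /=; rewrite mul0r subr0.
Qed.

Lemma rdotNl x y : rdot (- x) y = - rdot x y.
Proof.
by rewrite -scaleN1r -(mulN1r (rdot x y)) -rdotZl rmorphN1.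
Qed.

Lemma rdotBl x y z : rdot (x - y) z = rdot x z - rdot y z.
Proof. by rewrite rdotDl rdotNl. Qed.

Lemma rdotDr x y z : rdot x (y + z) = rdot x y + rdot x z.
Proof. by rewrite !(rdotC x) rdotDl. Qed.

Lemma rdotZr (a : R) x y : rdot x (a%:C *: y) = a * rdot x y.
Proof. by rewrite !(rdotC x) rdotZl. Qed.

Lemma rdotBr x y z : rdot x (y - z) = rdot x y - rdot x z.
Proof. by rewrite !(rdotC x) rdotBl. Qed.

Lemma rdotxx x : rdot x x = rnorm x ^+ 2.
Proof. by rewrite /rdot (dot_norm ip) rnormE -rmorphXn. Qed.

Lemma rdot0l x : rdot 0 x = 0.
Proof. by rewrite -(subrr 0) rdotBl subrr. Qed.

Lemma rdot_le x y : `|rdot x y| <= rnorm x * rnorm y.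
Proof.
have [/rnorm0_eq0 ->|x0] := eqVneq (rnorm x) 0.
  by rewrite rdot0l normr0 rnorm0 mul0r.
have [/rnorm0_eq0 ->|y0] := eqVneq (rnorm y) 0.
  by rewrite rdotC rdot0l normr0 rnorm0 mulr0.
have xy0 : 0 < rnorm x * rnorm y by rewrite mulr_gt0// lt_def ?x0 ?y0 rnorm_ge0.
set a := rnorm x in x0 xy0 *; set b := rnorm y in y0 xy0 *.
(* With a = |x| and b = |y|, expanding |b x - a y|^2 and |b x + a y|^2 gives the
   two signs of the inequality, multiplied by a b. *)
have hm := sqr_ge0 (rnorm (b%:C *: x - a%:C *: y)).
have hp := sqr_ge0 (rnorm (b%:C *: x + a%:C *: y)).
move: hm hp; rewrite -!rdotxx !(rdotBl, rdotBr, rdotDl, rdotDr, rdotZl, rdotZr).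
rewrite !rdotxx (rdotC y x) -/a -/b => hm hp.
by apply/ler_normlP; split; rewrite -(ler_pM2l xy0); nra.
Qed.

End inner_product_space.

(** * Strongly continuous semigroups: boundedness near zero *)

(** Sequences suffice for every limit taken below, and they match the way limits are
   constructed in a space of functions. *)
Definition cauchy_complete (R : realType) (H : normedModType R[i]) : Prop :=
  forall u : nat -> H,
    (forall e : R, 0 < e -> exists N, forall m n, (N <= m)%N -> (N <= n)%N ->
       rnorm (u m - u n) <= e) ->
    exists l : H, u n @[n --> \oo] --> l.

Section semigroup.
Context (R : realType) (H : normedModType R[i]) (V : R -> {linear H -> H}).
Hypothesis V_C0 : C0_semigroup V.

Lemma C0_right_continuous x e : 0 < e ->
  exists2 d : R, 0 < d & forall h, 0 < h < d -> rnorm (V h x - x) < e.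
Proof.
case: V_C0 => _ _ _ V0c e0.
by have /cvg_rnormP/(_ _ e0)/at_right0P := V0c x.
Qed.

(** Multiplying the difference quotient by [h] gives a form that the linear maps
   [V t] and the scalar product can be applied to directly. *)
Lemma generator_graphP x y : generator_graph V (x, y) <->
  forall e, 0 < e ->
    exists2 d : R, 0 < d &
      forall h, 0 < h < d -> rnorm (V h x - x - h%:C *: y) <= e * h.
Proof.
have E h : 0 < h -> rnorm (V h x - x - h%:C *: y) =
    h * rnorm (h^-1%:C *: (V h x - x) - y).
  move=> h0; rewrite -[X in _ = X * _](gtr0_norm h0) -rnormZ scalerBr scalerA.
  by rewrite -rmorphM divff ?gt_eqF// scale1r.
split=> [/cvg_rnormP xy e e0|xy].
  have /at_right0P[d d0 dP] := xy _ e0; exists d => // h hd.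
  have h0 : 0 < h by case/andP: hd.
  by rewrite E// mulrC ler_pM2r// ltW// dP.
apply/cvg_rnormP => e e0; apply/at_right0P.
have [|d d0 dP] := xy (e / 2); first by rewrite divr_gt0.
exists d => // h hd; have h0 : 0 < h by case/andP: hd.
have := dP h hd; rewrite E// mulrC ler_pM2r// => /le_lt_trans; apply; lra.
Qed.

Hypothesis H_complete : cauchy_complete H.

(** Were there no bound, each closed ball would contain a smaller one on which some
   [V t], with [t] as small as desired, is as large as desired.  The common point
   [l] of a sequence of such nested balls contradicts the convergence of [V h l]
   to [l]. *)
Lemma C0_bounded_near0 : exists2 d : R, 0 < d & exists2 M, 0 < M &
  forall t, 0 <= t <= d -> forall x, rnorm (V t x) <= M * rnorm x.
Proof.
apply: contrapT => unbounded.
have [Vcont V0 _ _] := V_C0.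
have blowup (d M : R) : 0 < d -> 1 <= M ->
    exists t x, [/\ 0 < t <= d & M * rnorm x < rnorm (V t x)].
  move=> d0 M1; apply: contrapT => nex; apply: unbounded; exists d => //.
  exists M; first by apply: lt_le_trans M1.
  move=> t /andP[t0 td] x; rewrite leNgt; apply/negP => Vtx; apply: nex.
  exists t, x; split => //; rewrite td andbT lt_def t0 andbT.
  by apply: contraTneq Vtx => ->; rewrite V0 -leNgt ler_peMl// rnorm_ge0.
(* The input is an index k, a centre and a radius; the output is a smaller ball
   inside the given one, and a time t <= 1 / (k + 1), such that V t is at least k
   on the smaller ball. *)
have step (kp : nat * (H * R)) : exists q : H * R * R, 0 < kp.2.2 ->
    [/\ 0 < q.1.2, q.1.2 <= kp.2.2 / 2, q.1.2 <= kp.1.+1%:R^-1,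
        0 < q.2 <= kp.1.+1%:R^-1 &
        rnorm (q.1.1 - kp.2.1) <= kp.2.2 / 2 /\
        forall z, rnorm (z - q.1.1) <= q.1.2 -> kp.1%:R <= rnorm (V q.2 z)].
  case: kp => k [x r] /=; have [r0|] := boolP (0 < r); last by exists (0, 0, 0).
  have k0 : 0 < k.+1%:R :> R by [].
  have [||t [w [/andP[t0 tk] Vtw]]] := blowup k.+1%:R^-1 (1 + 4 * k.+1%:R / r).
  - by rewrite invr_gt0.
  - by rewrite lerDl divr_ge0 ?ltW// mulr_gt0.
  have w0 : 0 < rnorm w.
    rewrite lt_def rnorm_ge0 andbT; apply: contraTneq Vtw => /rnorm0_eq0 ->.
    by rewrite linear0 rnorm0 mulr0 ltxx.
  (* Since V t z0 is larger than 2 (k + 1), one of V t x and V t (x + z0) is larger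
     than k + 1. *)
  have [z0 [z0r Vz0]] : exists z0, rnorm z0 <= r / 2 /\ 2 * k.+1%:R < rnorm (V t z0).
    exists ((r / 2 / rnorm w)%:C *: w); rewrite linearZ /= !rnormZ.
    rewrite gtr0_norm ?divr_gt0// divfK ?gt_eqF//; split=> //.
    rewrite mulrAC ltr_pdivlMr//.
    have : r / 2 * ((1 + 4 * k.+1%:R / r) * rnorm w) < r / 2 * rnorm (V t w).
      by rewrite ltr_pM2l// divr_gt0.
    apply: le_lt_trans.
    have -> : r / 2 * ((1 + 4 * k.+1%:R / r) * rnorm w) =
        r / 2 * rnorm w + 2 * k.+1%:R * rnorm w by field; rewrite gt_eqF.
    by rewrite lerDr mulr_ge0 ?divr_ge0// ltW.
  have [y [yr Vy]] : exists y, rnorm (y - x) <= r / 2 /\ k.+1%:R < rnorm (V t y).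
    have [Vx|Vx] := ltP k.+1%:R (rnorm (V t x)).
      by exists x; rewrite subrr rnorm0 divr_ge0// ltW.
    exists (x + z0); rewrite (addrC x) addrK; split=> //.
    have := rnorm_le_sub (V t z0) (- V t x).
    by rewrite opprK rnormN -(linearD (V t)) /=; lra.
  have [C C0 VC] := continuous_linear_rnorm (Vcont t (ltW t0)).
  exists (y, Num.min (Num.min (r / 2) C^-1) k.+1%:R^-1, t) => _ /=; split.
  - by rewrite !lt_min divr_gt0//= !invr_gt0 C0.
  - by rewrite !ge_min lexx.
  - by rewrite !ge_min lexx orbT.
  - by rewrite t0.
  split=> // z; rewrite !le_min => /andP[/andP[_ zC] _].
  have := rnorm_le_sub (V t y) (V t z); rewrite -(linearB (V t)) /=.
  have : rnorm (V t (y - z)) <= 1.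
    apply: le_trans (VC _) _; rewrite rnormBC.
    by rewrite mulrC -ler_pdivlMr// div1r.
  move: Vy; rewrite -natr1; lra.
have [F FP] := choice step.
pose s := fix s (k : nat) : H * R :=
  if k is k'.+1 then (F (k', s k')).1 else (0, 1).
pose t k := (F (k, s k)).2.
have s0 k : 0 < (s k).2.
  by elim: k => [|k IH] //=; have [] := FP (k, s k) IH.
have sP k : [/\ (s k.+1).2 <= (s k).2 / 2, (s k.+1).2 <= k.+1%:R^-1,
    0 < t k <= k.+1%:R^-1, rnorm ((s k.+1).1 - (s k).1) <= (s k).2 / 2 &
    forall z, rnorm (z - (s k.+1).1) <= (s k.+1).2 -> k%:R <= rnorm (V (t k) z)].
  by have [_ ? ? ? []] := FP (k, s k) (s0 k).
have nest k j : (k <= j)%N -> rnorm ((s j).1 - (s k).1) <= (s k).2 - (s j).2.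
  move=> /subnKC <-; elim: (j - k)%N => [|i IH]; first by rewrite addn0 !subrr rnorm0.
  rewrite addnS; have [h1 _ _ h2 _] := sP (k + i)%N.
  by apply: le_trans (rnorm_sub_trans (s (k + i)%N).1 _ _) _; lra.
have [|l sl] := H_complete (u := fun k => (s k).1).
  move=> e e0; have [N Ne] := exists_natr_gt (2 / e).
  exists N.+1 => m n Nm Nn; change (rnorm ((s m).1 - (s n).1) <= e).
  apply: le_trans (rnorm_sub_trans (s N.+1).1 _ _) _.
  rewrite (rnormBC (s N.+1).1); have := nest _ _ Nm; have := nest _ _ Nn.
  have [_ h1 _ _ _] := sP N; have := s0 m; have := s0 n.
  have : N.+1%:R^-1 <= e / 2.
    rewrite -[leRHS]invrK lef_pV2 ?posrE ?invr_gt0 ?divr_gt0// invf_div.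
    exact: ltW.
  move=> /(le_trans h1); lra.
have lball k : rnorm (l - (s k).1) <= (s k).2.
  apply/ler_addgt0Pr => e e0; move/cvg_rnormP: sl => /(_ e e0) [N _ /= NP].
  have /NP /= h1 : (N <= maxn N k)%N by rewrite leq_maxl.
  have h2 := nest k (maxn N k) (leq_maxr _ _).
  have := rnorm_sub_trans (s (maxn N k)).1 l (s k).1.
  rewrite (rnormBC l (s (maxn N k)).1); have := s0 (maxn N k); lra.
have [d d0 dP] := C0_right_continuous l ltr01.
(* An index beyond 1 / d gives a time below d, and one beyond |l| + 1 gives a
   value of the orbit of l too far from l. *)
have [k kP] := exists_natr_gt (d^-1 + rnorm l + 1).
have [_ _ /andP[t0 tk] _ /(_ l (lball k.+2)) big] := sP k.+1.
have kd : k.+2%:R^-1 < d.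
  rewrite -[ltRHS]invrK ltf_pV2 ?posrE ?invr_gt0//.
  rewrite -natr1; have := rnorm_ge0 l; lra.
have := dP (t k.+1); rewrite t0 (le_lt_trans tk kd) => /(_ isT).
have := rnorm_le_sub (V (t k.+1) l) l.
have : 0 < d^-1 by rewrite invr_gt0.
lra.
Qed.

End semigroup.

(** * Dissipative symmetric generators: contractivity and symmetry *)

Lemma dense_rnorm (R : realType) (H : normedModType R[i]) (D : set H) x e :
  dense D -> 0 < e -> exists2 y, D y & rnorm (x - y) < e.
Proof.
move=> dD e0.
have e0' : 0 < e%:C by rewrite ltcR.
have [|y [yx Dy]] := dD (ball x e%:C)^° _ (@open_interior _ _).
  by exists x; apply: nbhs_singleton; apply: nbhs_interior; exact: nbhsx_ballx.
exists y => //; have := interior_subset yx.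
by rewrite -ball_normE /= rnormE ltcR.
Qed.

Section dissipative_semigroup.
Context (R : realType) (H : normedModType R[i]) (V : R -> {linear H -> H}).
Context (dot : H -> H -> R[i]) (D : set H) (B : H -> H).
Hypothesis H_complete : cauchy_complete H.
Hypothesis ip : inner_product dot.
Hypothesis V_C0 : C0_semigroup V.
Hypothesis D_dense : dense D.
Hypothesis B_generator :
  forall x y, (D x /\ B x = y) <-> generator_graph V (x, y).
Hypothesis B_neg : forall x, D x -> rdot dot (B x) x <= 0.

Let V_cont t : 0 <= t -> continuous (V t). Proof. by case: V_C0 => + _ _ _; exact. Qed.
Let V_0 x : V 0 x = x. Proof. by case: V_C0. Qed.
Let V_D s t x : 0 <= s -> 0 <= t -> V (s + t) x = V s (V t x).
Proof. by case: V_C0 => _ _ VD _ s0 t0; exact: VD. Qed.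

Lemma generator_approx x e : D x -> 0 < e ->
  exists2 d : R, 0 < d &
    forall h, 0 < h < d -> rnorm (V h x - x - h%:C *: B x) <= e * h.
Proof.
move=> Dx e0.
by have /generator_graphP := (B_generator x (B x)).1 (conj Dx erefl); apply.
Qed.

(** [V t] commutes with the difference quotients of the semigroup and is continuous,
   so it maps a right derivative at [x] to one at [V t x]. *)
Lemma generator_commute t x : 0 <= t -> D x ->
  D (V t x) /\ B (V t x) = V t (B x).
Proof.
move=> t0 Dx; apply/B_generator/generator_graphP => e e0.
have [C C0 VC] := continuous_linear_rnorm (V_cont t0).
have [|d d0 dP] := @generator_approx x (e / C) Dx; first by rewrite divr_gt0.
exists d => // h hd; have h0 : 0 <= h by case/andP: hd => /ltW.
rewrite -V_D// (addrC h) V_D// -linearZ -!linearB /=.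
apply: le_trans (VC _) _; rewrite mulrC -ler_pdivlMr//.
by rewrite (mulrAC e) dP.
Qed.

(** The right derivative of $|V_t x|^2$ is $2 (B V_t x, V_t x) \le 0$.  The bound [M]
   on $[0, d]$ controls the left jump, because
   $V_t x - V_{t-h} x = V_{t-h} (V_h x - x)$. *)
Lemma orbit_contraction_near0 d M x : 0 <= d -> 0 < M ->
  (forall t, 0 <= t <= d -> forall x, rnorm (V t x) <= M * rnorm x) ->
  D x -> rnorm (V d x) <= rnorm x.
Proof.
move=> d0 M0 VM Dx.
rewrite -(@ler_pXn2r _ 2)// ?nnegrE ?rnorm_ge0// -[in leRHS](V_0 x).
apply: (@dini_nonincreasing _ (fun t => rnorm (V t x) ^+ 2)) => //.
- move=> t e /andP[t0 td] e0.
  (* If |V h x - x| <= eta <= 1, then |V t x|^2 exceeds |V (t - h) x|^2 by at most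
     K eta. *)
  pose K := M * (2 * M * rnorm x + M) + 1.
  have nx := rnorm_ge0 x.
  have K0 : 0 < K by rewrite /K; nra.
  pose eta := Num.min (e / K) 1.
  have eta0 : 0 < eta by rewrite lt_min divr_gt0//=.
  have [d' d'0 dP] := C0_right_continuous V_C0 x eta0; exists d' => // h hd' ht.
  have h0 : 0 <= h by case/andP: hd' => /ltW.
  have th0 : 0 <= t - h by rewrite subr_ge0.
  have hx := dP h hd'.
  have : rnorm (V t x) <= rnorm (V (t - h) x) + M * rnorm (V h x - x).
    apply: le_trans (rnorm_le_sub _ (V (t - h) x)) _; rewrite lerD2l.
    have -> : V t x = V (t - h) (V h x) by rewrite -V_D// subrK.
    by rewrite -linearB /= VM// th0 /=; lra.
  have : rnorm (V (t - h) x) <= M * rnorm x by apply: VM; rewrite th0 /=; lra.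
  have : eta * K <= e by rewrite -ler_pdivlMr// ge_min lexx.
  have eta1 : eta <= 1 by rewrite ge_min lexx orbT.
  move: (rnorm_ge0 (V t x)) (rnorm_ge0 (V (t - h) x)) (rnorm_ge0 (V h x - x)).
  rewrite /K; move: (rnorm (V t x)) (rnorm (V (t - h) x)) (rnorm (V h x - x)) hx.
  move=> a b c hx a0 b0 c0 eK bM abc.
  have : a ^+ 2 <= (b + M * c) ^+ 2.
    by rewrite ler_pXn2r ?nnegrE// addr_ge0// mulr_ge0// ltW.
  have : M * c <= M * eta by rewrite ler_pM2l// ltW.
  have : M * eta <= M by rewrite ger_pMr.
  have p0 : 0 <= M * c by rewrite mulr_ge0// ltW.
  move: eK bM p0; have -> : eta * (M * (2 * M * rnorm x + M) + 1) =
    M * eta * (2 * (M * rnorm x) + M) + eta by ring.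
  move: (M * eta) (M * c) (M * rnorm x) => q p N eK bN p0 qM pq ab.
  apply: (le_trans ab); rewrite sqrrD -addrA lerD2l.
  have : b * p <= N * q by rewrite ler_pM.
  have : p ^+ 2 <= M * q by rewrite expr2 ler_pM//; lra.
  lra.
- move=> t e /andP[t0 td] e0.
  have [Dw Bw] := generator_commute t0 Dx.
  set w := V t x in Dw Bw *.
  (* With z = V h w - w = h B w + rho and |rho| <= e' h, the increment of |V t x|^2
     is 2 (z, w) + |z|^2; the choice of e' bounds the first term by e h / 2, and h
     is taken small enough for |z|^2 <= e h / 2. *)
  pose e' := e / (4 * (rnorm w + 1)).
  have nw := rnorm_ge0 w; have nb := rnorm_ge0 (B w).
  have e'0 : 0 < e' by rewrite divr_gt0// mulr_gt0// ltr_pwDr.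
  have e'w : 4 * e' * (rnorm w + 1) = e by rewrite /e'; field; rewrite gt_eqF// ltr_pwDr.
  have [d1 d10 dP] := generator_approx Dw e'0.
  pose K := 2 * (rnorm (B w) + e') ^+ 2.
  have K0 : 0 < K by rewrite /K mulr_gt0// exprn_gt0// ltr_pwDr.
  exists (Num.min d1 (e / K)); first by rewrite lt_min d10 divr_gt0.
  move=> h /andP[h0]; rewrite lt_min => /andP[hd1 hK] _.
  rewrite addrC V_D ?(ltW h0)// -/w.
  have hr := dP h; rewrite h0 hd1 in hr; have {}hr := hr isT.
  set z := V h w - w; set rho := z - h%:C *: B w in hr.
  have zE : V h w = w + z by rewrite /z addrC subrK.
  have zr : z = h%:C *: B w + rho by rewrite /rho addrC subrK.
  have h1 : rdot dot z w <= e' * h * rnorm w.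
    rewrite zr (rdotDl ip) (rdotZl ip).
    have := rdot_le ip rho w; move=> /ler_normlP[_ r1].
    have : h * rdot dot (B w) w <= 0 by rewrite pmulr_rle0// B_neg.
    have : rnorm rho * rnorm w <= e' * h * rnorm w by rewrite ler_wpM2r.
    lra.
  have h2 : rnorm z <= h * (rnorm (B w) + e').
    by rewrite zr; apply: le_trans (rnormD _ _) _; rewrite rnormZ gtr0_norm//; lra.
  have h3 : rnorm z ^+ 2 <= h * (e / 2).
    apply: (@le_trans _ _ ((h * (rnorm (B w) + e')) ^+ 2)).
      by rewrite ler_pXn2r// nnegrE ?rnorm_ge0// mulr_ge0 ?(ltW h0)// addr_ge0// ltW.
    rewrite exprMn expr2 -mulrA ler_pM2l//.
    by move: hK; rewrite ltr_pdivlMr// /K; lra.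
  clearbody rho z; rewrite zE -!(rdotxx ip) (rdotDl ip) !(rdotDr ip) !(rdotxx ip).
  rewrite (rdotC ip w z).
  have : e' * h * rnorm w * 4 <= e * h.
    by rewrite -e'w; nra.
  lra.
Qed.

(** Near [t = 0], contractivity passes from the dense set [D] to all of [H] by the
   local bound; any other time is a multiple of a small one. *)
Lemma dissipative_contraction t x : 0 <= t -> rnorm (V t x) <= rnorm x.
Proof.
have [d d0 [M M0 VM]] := C0_bounded_near0 V_C0 H_complete.
have small r y : 0 <= r <= d -> rnorm (V r y) <= rnorm y.
  move=> /andP[r0 rd]; apply/ler_addgt0Pr => e e0.
  have e'0 : 0 < e / (M + 1) by rewrite divr_gt0// ltr_pwDr// ltW.
  have [w Dw yw] := dense_rnorm y D_dense e'0.
  have Vw : rnorm (V r w) <= rnorm w.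
    apply: (orbit_contraction_near0 r0 M0) => // u /andP[u0 ur] z.
    by apply: VM; rewrite u0 (le_trans ur).
  have Vyw : rnorm (V r y - V r w) <= M * rnorm (y - w).
    by rewrite -linearB; apply: VM; rewrite r0.
  have := rnorm_le_sub (V r y) (V r w).
  have := rnorm_le_sub w y; rewrite (rnormBC w).
  have : (M + 1) * rnorm (y - w) <= e.
    by rewrite mulrC -ler_pdivlMr ?ltW// ltr_pwDr// ltW.
  lra.
have iterated r n y : 0 <= r <= d -> rnorm (V (r *+ n) y) <= rnorm y.
  move=> /andP[r0 rd]; elim: n => [|n IH]; first by rewrite mulr0n V_0.
  rewrite mulrS V_D ?mulrn_wge0//; apply: le_trans IH.
  by apply: small; rewrite r0.
move=> t0; have [n tn] := exists_natr_gt (t / d).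
have -> : t = (t / n.+1%:R) *+ n.+1 by rewrite -mulr_natr divfK.
apply: iterated; rewrite divr_ge0//= ler_pdivrMr// mulrC.
by rewrite -ler_pdivrMr// ltW.
Qed.

Lemma orbit_right_lipschitz t h x : 0 <= t -> 0 <= h ->
  rnorm (V (t + h) x - V t x) <= rnorm (V h x - x).
Proof. by move=> t0 h0; rewrite V_D// -linearB dissipative_contraction. Qed.

Hypothesis B_sym :
  forall x y, D x -> D y -> rdot dot (B x) y = rdot dot x (B y).

(** The function $r \mapsto (V_{t-r} x, V_r y)$ has right derivative
   $(V_{t-r} x, B V_r y) - (B V_{t-r} x, V_r y) = 0$, and its values at [t] and [0]
   are the two sides.  Exchanging [x] and [y] gives the converse inequality. *)
Let symmetric_semigroup_le t x y : 0 <= t -> D x -> D y ->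
  rdot dot x (V t y) <= rdot dot (V t x) y.
Proof.
move=> t0 Dx Dy; have nx := rnorm_ge0 x; have ny := rnorm_ge0 y.
pose K := rnorm x + rnorm y + 1; have K0 : 0 < K by rewrite /K; lra.
have := @dini_nonincreasing _ (fun r => rdot dot (V (t - r) x) (V r y)) t t0.
rewrite /= subrr subr0 !V_0; apply.
- move=> r e /andP[r0 rt] e0; have rr := ltW r0.
  have e'0 : 0 < e / K by rewrite divr_gt0.
  have [d1 d10 dx] := C0_right_continuous V_C0 x e'0.
  have [d2 d20 dy] := C0_right_continuous V_C0 y e'0.
  exists (Num.min d1 d2); first by rewrite lt_min d10.
  move=> h /andP[h0]; rewrite lt_min => /andP[hd1 hd2] hr.
  have hh := ltW h0.
  have {dx} := dx h; rewrite h0 hd1 => /(_ isT) dx.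
  have {dy} := dy h; rewrite h0 hd2 => /(_ isT) dy.
  have rh0 : 0 <= r - h by rewrite subr_ge0.
  have tr0 : 0 <= t - r by rewrite subr_ge0.
  have lx : rnorm (V (t - (r - h)) x - V (t - r) x) <= rnorm (V h x - x).
    have -> : t - (r - h) = t - r + h by rewrite opprB addrA addrAC.
    exact: orbit_right_lipschitz.
  have ly : rnorm (V r y - V (r - h) y) <= rnorm (V h y - y).
    by have := orbit_right_lipschitz y rh0 hh; rewrite subrK.
  have cx := dissipative_contraction x tr0.
  have cy := dissipative_contraction y rh0.
  set a := V (t - r) x in lx cx *; set b := V r y in ly *.
  set a' := V (t - (r - h)) x in lx *; set b' := V (r - h) y in ly cy *.
  have E : rdot dot a b - rdot dot a' b' =
    rdot dot a (b - b') - rdot dot (a' - a) b' by rewrite (rdotBr ip) (rdotBl ip); ring.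
  have /ler_normlP[_ c1] := rdot_le ip a (b - b').
  have /ler_normlP[c2 _] := rdot_le ip (a' - a) b'.
  have m1 : rnorm a * rnorm (b - b') <= rnorm x * (e / K).
    by rewrite ler_pM ?rnorm_ge0//; lra.
  have m2 : rnorm (a' - a) * rnorm b' <= (e / K) * rnorm y.
    by rewrite ler_pM ?rnorm_ge0//; lra.
  have m3 : rnorm x * (e / K) + (e / K) * rnorm y + e / K = e.
    by rewrite /K; field; rewrite gt_eqF.
  lra.
- move=> r e /andP[r0 rt] e0.
  have e'0 : 0 < e / K by rewrite divr_gt0.
  have [d1 d10 dx] := generator_approx Dx e'0.
  have [d2 d20 dy] := generator_approx Dy e'0.
  exists (Num.min d1 d2); first by rewrite lt_min d10.
  move=> h /andP[h0]; rewrite lt_min => /andP[hd1 hd2] hr.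
  have hh := ltW h0.
  have {dx} := dx h; rewrite h0 hd1 => /(_ isT) dx.
  have {dy} := dy h; rewrite h0 hd2 => /(_ isT) dy.
  have s0 : 0 <= t - (r + h) by rewrite subr_ge0.
  set s := t - (r + h) in s0 *.
  have -> : t - r = s + h by rewrite /s opprD addrA subrK.
  have [Dq Bq] := generator_commute s0 Dx; have [Dp Bp] := generator_commute r0 Dy.
  have cx := dissipative_contraction x s0.
  have cy := dissipative_contraction y r0.
  have lx := le_trans (dissipative_contraction _ s0) dx.
  have ly := le_trans (dissipative_contraction _ r0) dy.
  (* At time s = t - r - h the term B q cancels exactly against B p, and only the
     remainders of the two difference quotients are left. *)
  move: lx ly; rewrite !linearB (linearZ_LR (V s)) (linearZ_LR (V r)) -!V_D// -Bq -Bp.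
  have := B_sym Dq Dp.
  set q := V s x in Dq cx *; set p := V r y in Dp cy *.
  set q' := V (s + h) x; set p' := V (r + h) y => qp lx ly.
  have E : rdot dot q p' - rdot dot q' p =
    rdot dot q (p' - p - h%:C *: B p) - rdot dot (q' - q - h%:C *: B q) p.
    by rewrite !(rdotBr ip, rdotBl ip, rdotZr ip, rdotZl ip) qp; ring.
  have /ler_normlP[_ c1] := rdot_le ip q (p' - p - h%:C *: B p).
  have /ler_normlP[c2 _] := rdot_le ip (q' - q - h%:C *: B q) p.
  have m1 : rnorm q * rnorm (p' - p - h%:C *: B p) <= rnorm x * (e / K * h).
    by rewrite ler_pM ?rnorm_ge0//.
  have m2 : rnorm (q' - q - h%:C *: B q) * rnorm p <= (e / K * h) * rnorm y.
    by rewrite ler_pM ?rnorm_ge0//.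
  have m3 : rnorm x * (e / K * h) + (e / K * h) * rnorm y + e / K * h = e * h.
    by rewrite /K; field; rewrite gt_eqF.
  have m4 : 0 < e / K * h by rewrite mulr_gt0.
  lra.
Qed.

Lemma symmetric_semigroup t x y : 0 <= t ->
  rdot dot (V t x) y = rdot dot x (V t y).
Proof.
move=> t0.
have onD a b : D a -> D b -> rdot dot (V t a) b = rdot dot a (V t b).
  move=> Da Db; apply/eqP; rewrite eq_le symmetric_semigroup_le// andbT.
  by rewrite (rdotC ip _ b) (rdotC ip a) symmetric_semigroup_le.
(* Both sides are bounded bilinear forms in (x, y) that agree on the dense D. *)
have key (e : R) : 0 < e -> e <= 1 ->
    `|rdot dot (V t x) y - rdot dot x (V t y)| <= 2 * e * (rnorm x + rnorm y + 1).
  move=> e0 e1; have [a Da xa] := dense_rnorm x D_dense e0.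
  have [b Db yb] := dense_rnorm y D_dense e0.
  have E : rdot dot (V t x) y - rdot dot x (V t y) =
      rdot dot (V t (x - a)) y + rdot dot (V t a) (y - b)
      - (rdot dot (x - a) (V t y) + rdot dot a (V t (y - b))).
    rewrite !linearB !(rdotBr ip, rdotBl ip) (onD _ _ Da Db); ring.
  have V1 u v : `|rdot dot (V t u) v| <= rnorm u * rnorm v.
    apply: le_trans (rdot_le ip _ _) _.
    by rewrite ler_wpM2r ?rnorm_ge0// dissipative_contraction.
  have V2 u v : `|rdot dot u (V t v)| <= rnorm u * rnorm v.
    by rewrite (rdotC ip) mulrC V1.
  have an : rnorm a <= rnorm x + 1.
    by have := rnorm_le_sub a x; rewrite rnormBC; lra.
  have {V1}[c1 c2] := (V1 (x - a) y, V1 a (y - b)).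
  have {V2}[c3 c4] := (V2 (x - a) y, V2 a (y - b)).
  have m1 : rnorm (x - a) * rnorm y <= e * rnorm y.
    by rewrite ler_wpM2r ?rnorm_ge0// ltW.
  have m2 : rnorm a * rnorm (y - b) <= (rnorm x + 1) * e.
    by rewrite ler_pM ?rnorm_ge0// ltW.
  rewrite E; apply: le_trans (ler_normB _ _) _.
  apply: le_trans (lerD (ler_normD _ _) (ler_normD _ _)) _; lra.
apply/eqP; rewrite -subr_eq0 -normr_le0; apply/ler_addgt0Pr => e e0; rewrite add0r.
pose K := 2 * (rnorm x + rnorm y + 1).
have K0 : 0 < K by rewrite mulr_gt0// ltr_wpDl ?addr_ge0 ?rnorm_ge0.
have /key : 0 < Num.min (e / K) 1 by rewrite lt_min divr_gt0/=.
rewrite ge_min lexx orbT => /(_ isT) /le_trans -> //.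
rewrite mulrAC (mulrC _ (Num.min _ _)) -/K -ler_pdivlMr//.
by rewrite ge_min lexx.
Qed.

(** * Convergence of orbits *)

(** The increments of $V_r h - h$ are bounded by $|V_s h - h|$, which is $o(s)$ when
   $B h = 0$. *)
Lemma kernel_fixed t h : 0 <= t -> D h -> B h = 0 -> V t h = h.
Proof.
move=> t0 Dh Bh; apply/eqP; rewrite -subr_eq0; apply/eqP/rnorm0_eq0/eqP.
rewrite eq_le rnorm_ge0 andbT.
have := @dini_nonincreasing _ (fun r => rnorm (V r h - h)) t t0.
rewrite /= V_0 subrr rnorm0; apply.
- move=> r e /andP[r0 rt] e0.
  have [d d0 dP] := C0_right_continuous V_C0 h e0.
  exists d => // s sd sr; have s0 : 0 <= s by case/andP: sd => /ltW.
  apply: le_trans (rnorm_sub_trans (V (r - s) h) _ _) _.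
  rewrite addrC lerD2l; apply: le_trans (ltW (dP s sd)).
  have rs0 : 0 <= r - s by rewrite subr_ge0.
  have -> : V r h = V (r - s) (V s h) by rewrite -V_D// subrK.
  by rewrite -linearB dissipative_contraction.
- move=> r e /andP[r0 rt] e0.
  have [d d0 dP] := generator_approx Dh e0.
  exists d => // s sd _; have s0 : 0 <= s by case/andP: sd => /ltW.
  have := dP s sd; rewrite Bh scaler0 subr0 => dPs.
  apply: le_trans (rnorm_sub_trans (V r h) _ _) _.
  rewrite addrC lerD2l; apply: le_trans dPs.
  by rewrite V_D// -linearB dissipative_contraction.
Qed.

(** With $\phi(t) = (V_t f, f)$ nonincreasing and bounded below, all of $\phi(2t)$,
   $\phi(2r)$ and $\phi(t+r)$ are eventually within $e^2 / 2$ of $\inf \phi$. *)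
Lemma orbit_cauchy f e : 0 < e ->
  exists2 t0, 0 <= t0 & forall t r, t0 <= t -> t0 <= r ->
    rnorm (V t f - V r f) <= e.
Proof.
move=> e0; pose phi t := rdot dot (V t f) f.
have phiD t r : 0 <= t -> 0 <= r -> rdot dot (V t f) (V r f) = phi (t + r).
  move=> t0 r0; rewrite /phi addrC V_D// symmetric_semigroup//.
  by rewrite symmetric_semigroup// -symmetric_semigroup.
have phi_half t : 0 <= t -> phi t = rnorm (V (t / 2) f) ^+ 2.
  move=> t0; rewrite -(rdotxx ip) phiD ?divr_ge0//; congr phi; lra.
have phi_noninc s t : 0 <= s -> s <= t -> phi t <= phi s.
  move=> s0 st; have t0 := le_trans s0 st; rewrite !phi_half//.
  rewrite ler_pXn2r ?nnegrE ?rnorm_ge0//.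
  have -> : t / 2 = (t - s) / 2 + s / 2 by lra.
  by rewrite V_D ?divr_ge0 ?subr_ge0// dissipative_contraction// divr_ge0 ?subr_ge0.
pose S := [set phi t | t in [set t | 0 <= t]].
have S_inf : has_inf S.
  split; first by exists (phi 0), 0 => /=.
  by exists 0 => _ [t /= t0 <-]; rewrite phi_half// sqr_ge0.
have inf_le t : 0 <= t -> inf S <= phi t.
  by move=> t0; apply: ge_inf; [case: S_inf|exists t].
have e20 : 0 < e ^+ 2 / 2 by rewrite divr_gt0// exprn_gt0.
have [_ [t0 /= t00 <-] t0S] := inf_adherent e20 S_inf.
exists t0 => // t r t0t t0r.
have tt := le_trans t00 t0t; have rr := le_trans t00 t0r.
rewrite -(@ler_pXn2r _ 2)// ?nnegrE ?rnorm_ge0// ?ltW//.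
rewrite -(rdotxx ip) (rdotBl ip) !(rdotBr ip) (rdotC ip (V r f) (V t f)) !phiD//.
have := inf_le _ (addr_ge0 tt rr).
have : phi (t + t) <= phi t0 by apply: phi_noninc => //; lra.
have : phi (r + r) <= phi t0 by apply: phi_noninc => //; lra.
lra.
Qed.

(** The limit [g] is the projection of [f] onto the kernel of [B]: it is fixed by the
   semigroup, and $(f, h) = (f, V_t h) = (V_t f, h)$ for every [h] in the kernel. *)
Theorem orbit_converges f : exists g : H,
  [/\ V t f @[t --> +oo] --> g, D g, B g = 0 &
      forall h, D h -> B h = 0 -> rdot dot (f - g) h = 0].
Proof.
have [|g ng] := @H_complete (fun n => V n%:R f).
  move=> e e0; have [t0 t00 tP] := orbit_cauchy f e0.
  have [N NP] := exists_natr_gt t0; exists N.+1 => m n Nm Nn.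
  by apply: tP; apply: ltW; apply: (lt_le_trans NP); rewrite ler_nat.
have lim e : 0 < e -> exists2 t0, 0 <= t0 & forall t, t0 <= t -> rnorm (V t f - g) < e.
  move=> e0; have e20 : 0 < e / 2 by rewrite divr_gt0.
  have [t0 t00 tP] := orbit_cauchy f e20.
  move/cvg_rnormP: ng => /(_ _ e20) [N _ NP]; have [M MP] := exists_natr_gt t0.
  exists t0 => // t t0t; apply: le_lt_trans (rnorm_sub_trans (V (N + M.+1)%:R f) _ _) _.
  have /NP /= : (N <= N + M.+1)%N by rewrite leq_addr.
  have : t0 <= (N + M.+1)%:R by rewrite natrD; have := ler0n R N; lra.
  by move=> /(tP t _ t0t); lra.
have fixed r : 0 <= r -> V r g = g.
  move=> r0; apply/eqP; rewrite -subr_eq0; apply/eqP/rnorm0_eq0/eqP.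
  rewrite eq_le rnorm_ge0 andbT; apply/ler_addgt0Pr => e e0; rewrite add0r.
  have [|t0 t00 tP] := lim (e / 2); first by rewrite divr_gt0.
  apply: le_trans (rnorm_sub_trans (V (r + t0) f) _ _) _.
  have : rnorm (V (r + t0) f - g) < e / 2 by apply: tP; rewrite lerDr.
  have : rnorm (V r g - V (r + t0) f) <= rnorm (V t0 f - g).
    by rewrite V_D// -linearB (rnormBC (V t0 f)) dissipative_contraction.
  have := tP t0 (lexx _); lra.
have [Dg Bg] : D g /\ B g = 0.
  apply/B_generator/generator_graphP => e e0; exists 1 => // h /andP[h0 _].
  by rewrite (fixed _ (ltW h0)) subrr scaler0 subr0 rnorm0 mulr_ge0// ltW.
exists g; split=> //.
  apply/cvg_rnormP => e e0; have [t0 t00 tP] := lim e e0.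
  by exists t0; split; [exact: num_real|move=> t /ltW /tP].
move=> h Dh Bh; apply/eqP; rewrite -normr_le0; apply/ler_addgt0Pr => e e0.
rewrite add0r; have [|t0 t00 tP] := lim (e / (rnorm h + 1)).
  by rewrite divr_gt0// ltr_pwDr// rnorm_ge0.
have -> : rdot dot (f - g) h = rdot dot (V t0 f - g) h.
  by rewrite !(rdotBl ip) symmetric_semigroup// kernel_fixed.
apply: le_trans (rdot_le ip _ _) _.
have := tP t0 (lexx _); rewrite ltr_pdivlMr ?ltr_pwDr ?rnorm_ge0//.
have := rnorm_ge0 (V t0 f - g); lra.
Qed.

End dissipative_semigroup.

(** * Numerical range and spectral bound *)

Section numerical_range.
Context (R : realType) (H : normedModType R[i]) (dot : H -> H -> R[i]).
Context (A : unbounded_operator H).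
Hypothesis ip : inner_product dot.
Hypothesis A_sym :
  forall x y, dom A x -> dom A y -> rdot dot (A x) y = rdot dot x (A y).

(** Let $S$ be the resolvent at $m$, bounded by $C$, and $w = S x$.  The form
   $((m - A) z, z)$ is nonnegative on the domain; at $z = x - w / C$ this reads
   $0 \le ((m - A) x, x) - 2 |x|^2 / C + (x, w) / C^2$, and $(x, w) \le C |x|^2$. *)
Lemma resolvent_numerical_gap (m : R) :
  (forall x, dom A x -> rdot dot (A x) x <= m * rnorm x ^+ 2) ->
  resolvent_set A m%:C ->
  exists2 c, 0 < c & forall x, dom A x ->
    rdot dot (A x) x <= (m - c) * rnorm x ^+ 2.
Proof.
move=> Am [S [Sc Sr Sl]]; have [C C0 SC] := continuous_linear_rnorm Sc.
exists C^-1; first by rewrite invr_gt0.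
move=> x Dx; pose w := S x; have [Dw wE] := Sr x.
pose z := (- C^-1)%:C *: w + x.
have Dz : dom A z by exact: dom_linear.
have Az : A z = (- C^-1)%:C *: A w + A x by exact: op_linear.
have xw : rdot dot x w <= C * rnorm x ^+ 2.
  have /ler_normlP[_ /le_trans ->//] := rdot_le ip x w.
  by rewrite mulrC expr2 mulrA ler_wpM2r ?rnorm_ge0// SC.
have xx : m * rdot dot x w - rdot dot x (A w) = rnorm x ^+ 2.
  by rewrite -(rdotZr ip) -(rdotBr ip) wE (rdotxx ip).
have ww : m * rdot dot w w - rdot dot (A w) w = rdot dot x w.
  by rewrite -(rdotZl ip) -(rdotBl ip) wE.
have := Am _ Dz; rewrite Az -(rdotxx ip).
rewrite !(rdotDl ip, rdotDr ip, rdotZl ip, rdotZr ip) (rdotxx ip x).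
rewrite (rdotC ip (A w) x) (rdotC ip w x) (A_sym Dx Dw).
have CC : C^-1 * C = 1 by rewrite mulVf// gt_eqF.
have Ci0 : 0 < C^-1 by rewrite invr_gt0.
have : C^-1 * C^-1 * rdot dot x w <= C^-1 * rnorm x ^+ 2.
  by rewrite -mulrA ler_pM2l// mulrC ler_pdivrMr// mulrC.
move: xx ww; move: (rdot dot x w) (rdot dot x (A w)) (rdot dot w w) (rdot dot (A w) w).
move: (rnorm x ^+ 2) (rdot dot (A x) x) C^-1 => n q c a b e g nE aE h.
rewrite -{}nE -{}aE in h *.
nra.
Qed.

(** The supremum of the numerical range belongs to the spectrum, since otherwise
   resolvent_numerical_gap would give a smaller upper bound. *)
Lemma numerical_range_le_spectral_bound :
  (forall x, dom A x -> rdot dot (A x) x <= 0) ->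
  forall x, dom A x -> rdot dot (A x) x <= spectral_bound A * rnorm x ^+ 2.
Proof.
move=> A_neg.
pose N := [set q | exists x, [/\ dom A x, rnorm x = 1 & q = rdot dot (A x) x]].
have N_ub : has_ubound N by exists 0 => q [x [Dx _ ->]]; exact: A_neg.
have normalized (c : R) : (forall q, N q -> q <= c) ->
    forall x, dom A x -> rdot dot (A x) x <= c * rnorm x ^+ 2.
  move=> Nc x Dx; have [/rnorm0_eq0 ->|x0] := eqVneq (rnorm x) 0.
    by rewrite (rdotC ip) (rdot0l ip) rnorm0 expr0n mulr0.
  have nx : 0 < rnorm x by rewrite lt_def x0 rnorm_ge0.
  pose y := (rnorm x)^-1%:C *: x + 0.
  have Dy : dom A y by apply: dom_linear => //; exact: dom0.
  have A0 : A 0 = 0.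
    have := op_linear (-1) (dom0 A) (dom0 A); rewrite scaler0 addr0 scaleN1r.
    by rewrite addNr.
  have Ay : A y = (rnorm x)^-1%:C *: A x.
    by rewrite /y op_linear// ?A0 ?addr0//; exact: dom0.
  have : rdot dot (A y) y <= c.
    apply: Nc; exists y; split=> //.
    by rewrite /y addr0 rnormZ gtr0_norm ?invr_gt0// mulVf.
  rewrite Ay /y addr0 (rdotZl ip) (rdotZr ip) mulrA -invfM mulrC.
  by rewrite ler_pdivrMr ?mulr_gt0.
have [[q0 Nq0]|N0] := pselect (N !=set0); last first.
  by apply: normalized => q Nq; exfalso; apply: N0; exists q.
have Nsup q : N q -> q <= sup N by move=> Nq; exact: ub_le_sup.
apply: (normalized (spectral_bound A)) => q /Nsup /le_trans; apply.
have spec : spectrum A (sup N)%:C.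
  move=> /(resolvent_numerical_gap (normalized _ Nsup))[c c0 gap].
  suff : sup N <= sup N - c by lra.
  apply: ge_sup; first by exists q0.
  by move=> _ [x [Dx x1 ->]]; have := gap x Dx; rewrite x1 expr1n mulr1.
rewrite /spectral_bound; set E := [set complex.Re l | l in _].
have [hE|nE] := pselect (has_sup E).
  by apply: sup_upper_bound => //; exists (sup N)%:C.
(* If the real parts of the spectrum had no supremum, the spectral bound would
   take the default value 0, which still bounds the numerical range. *)
rewrite (sup_out nE); apply: ge_sup; first by exists q0.
by move=> _ [x [Dx _ ->]]; exact: A_neg.
Qed.

End numerical_range.

(** * The rescaled semigroup converges to the projector *)

Section rescaling.
Context (R : realType) (H : normedModType R[i]).

(** Applied with [a = - s] and then backwards with [a = s], this shows that the
   generator of the rescaled semigroup is exactly $A - s$. *)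
Lemma rescaled_generator (T V : R -> {linear H -> H}) (a : R) x y :
  (forall t z, V t z = (expR (t * a))%:C *: T t z) ->
  generator_graph T (x, y) -> generator_graph V (x, y + a%:C *: x).
Proof.
move=> VT /generator_graphP Txy; apply/generator_graphP => e e0.
have nx := rnorm_ge0 x; have ny := rnorm_ge0 y.
pose K := 2 + rnorm x + rnorm y; have K0 : 0 < K by rewrite /K; lra.
pose e1 := Num.min 1 (e / K).
have e10 : 0 < e1 by rewrite lt_min ltr01 divr_gt0.
have e11 : e1 <= 1 by rewrite ge_min lexx.
have e1K : e1 * K <= e by rewrite -ler_pdivlMr// ge_min lexx orbT.
have [d1 d10 P1] := Txy e1 e10; have [d2 d20 P2] := expR_linear_approx a e10.
exists (Num.min d1 d2); first by rewrite lt_min d10.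
move=> h /andP[h0]; rewrite lt_min => /andP[h1 h2].
have := P1 h; rewrite h0 h1 => /(_ isT); have := P2 h; rewrite h0 h2 => /(_ isT).
rewrite VT; set c := expR (h * a); set rho := T h x - x - _ => -[c1 c2] r.
have -> : c%:C *: T h x - x - h%:C *: (y + a%:C *: x) =
    c%:C *: rho + ((c - 1 - h * a)%:C *: x + (h * (c - 1))%:C *: y).
  have -> : T h x = rho + (x + h%:C *: y) by rewrite /rho addrACA subrK addNr addr0.
  clearbody rho; rewrite scalerDr -[LHS]addrA -[LHS]addrA; congr (_ + _).
  rewrite !(rmorphB, rmorphM) rmorph1 !scalerBl scale1r /= mulrBr mulr1 scalerBl.
  rewrite !scalerDr !scalerA (mulrC h%:C c%:C) opprD [in LHS]addrA.
  by rewrite (addrAC (c%:C *: x)) (addrC (- (h%:C *: y))) [LHS]addrACA.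
apply: le_trans (rnormD _ _) _.
apply: le_trans (lerD (lexx _) (rnormD _ _)) _; rewrite !rnormZ.
have m1 : `|c| * rnorm rho <= 2 * (e1 * h).
  rewrite ler_pM ?rnorm_ge0//.
  have := ler_normD (c - 1) 1; rewrite subrK normr1; lra.
have m2 : `|c - 1 - h * a| * rnorm x <= e1 * h * rnorm x by rewrite ler_wpM2r.
have m3 : `|h * (c - 1)| * rnorm y <= h * e1 * rnorm y.
  by rewrite ler_wpM2r// normrM gtr0_norm// ler_pM2l.
have : e1 * K * h <= e * h by rewrite ler_pM2r.
rewrite /K; lra.
Qed.

Lemma rescaled_C0 (T V : R -> {linear H -> H}) (a : R) :
  (forall t z, V t z = (expR (t * a))%:C *: T t z) ->
  C0_semigroup T -> C0_semigroup V.
Proof.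
move=> VT T_C0; have [Tc T0 TD T0c] := T_C0; split.
- move=> t t0 x; have -> : V t = (fun z => (expR (t * a))%:C *: T t z) :> (H -> H).
    by apply/funext => z; rewrite VT.
  by apply: cvgZr; exact: Tc.
- by move=> x; rewrite VT T0 mul0r expR0 scale1r.
- move=> s t s0 t0 x; rewrite !VT TD// linearZ /= scalerA -rmorphM.
  by rewrite mulrDl expRD.
- move=> x; apply/cvg_rnormP => e e0; apply/at_right0P.
  have nx := rnorm_ge0 x.
  pose e1 := Num.min 1 (e / (3 + rnorm x)).
  have e10 : 0 < e1 by rewrite lt_min ltr01 divr_gt0//; lra.
  have e11 : e1 <= 1 by rewrite ge_min lexx.
  have e1K : e1 * (3 + rnorm x) <= e.
    by rewrite -ler_pdivlMr ?ge_min ?lexx ?orbT//; lra.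
  have [d1 d10 P1] := C0_right_continuous T_C0 x e10.
  have [d2 d20 P2] := expR_linear_approx a e10.
  exists (Num.min d1 d2); first by rewrite lt_min d10.
  move=> h /andP[h0]; rewrite lt_min => /andP[h1 h2].
  have := P1 h; rewrite h0 h1 => /(_ isT); have := P2 h; rewrite h0 h2 => /(_ isT).
  rewrite VT; set c := expR (h * a) => -[_ c2] r.
  have -> : c%:C *: T h x - x = c%:C *: (T h x - x) + (c - 1)%:C *: x.
    by rewrite rmorphB rmorph1 scalerBl scale1r scalerBr addrA subrK.
  apply: le_lt_trans (rnormD _ _) _; rewrite !rnormZ.
  have m1 : `|c| * rnorm (T h x - x) <= 2 * e1.
    rewrite ler_pM ?rnorm_ge0 ?(ltW r)//.
    have := ler_normD (c - 1) 1; rewrite subrK normr1; lra.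
  have m2 : `|c - 1| * rnorm x <= e1 * rnorm x by rewrite ler_wpM2r.
  lra.
Qed.

End rescaling.

(** The rescaled semigroup is generated by $A - s$, which is symmetric and negative
   semidefinite, and the kernel of $A - s$ is the eigenspace.  Two elements of the
   eigenspace whose differences with [f] are orthogonal to it coincide. *)
Theorem exp_semigroup_cvg_projector (R : realType) (H : normedModType R[i])
    (dot : H -> H -> R[i]) (A : unbounded_operator H)
    (T : R -> {linear H -> H}) (P : H -> H) :
  cauchy_complete H -> inner_product dot ->
  self_adjoint dot A -> negative_semidefinite dot A -> exp_semigroup A T ->
  orthogonal_projector dot (op_eigenspace A (spectral_bound A)%:C) P ->
  forall f, (expR (- (t * spectral_bound A)))%:C *: T t f @[t --> +oo] --> P f.
Proof.
move=> Hc ip [A_dense A_adj] A_neg [T_C0 A_gen] P_proj f.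
set s := spectral_bound A in P_proj *.
have A_sym x y : dom A x -> dom A y -> rdot dot (A x) y = rdot dot x (A y).
  move=> Dx Dy; have : op_graph A (y, A y) by [].
  by rewrite A_adj => /(_ x Dx) /= E; rewrite /rdot E.
have A_npos x : dom A x -> rdot dot (A x) x <= 0.
  by move=> /A_neg; rewrite lecE => /andP[].
have A_le := numerical_range_le_spectral_bound ip A_sym A_npos.
pose V t : {linear H -> H} := (expR (t * - s))%:C \*: T t.
have VT t z : V t z = (expR (t * - s))%:C *: T t z by [].
have TV t z : T t z = (expR (t * s))%:C *: V t z.
  by rewrite VT scalerA -rmorphM -expRD -mulrDr subrr mulr0 expR0 scale1r.
pose B x := A x - s%:C *: x.
have V_gen x y : (dom A x /\ B x = y) <-> generator_graph V (x, y).
  split=> [[Dx <-]|Vxy].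
    have -> : B x = A x + (- s)%:C *: x by rewrite /B rmorphN scaleNr.
    by apply: (rescaled_generator VT); rewrite -A_gen.
  have := rescaled_generator TV Vxy; rewrite -A_gen => -[/= Dx Ax].
  by split=> //; rewrite /B Ax addrK.
have B_neg x : dom A x -> rdot dot (B x) x <= 0.
  move=> Dx; rewrite (rdotBl ip) (rdotZl ip) (rdotxx ip) subr_le0.
  exact: A_le.
have B_sym x y : dom A x -> dom A y -> rdot dot (B x) y = rdot dot x (B y).
  by move=> Dx Dy; rewrite (rdotBl ip) (rdotBr ip) (rdotZl ip) (rdotZr ip) A_sym.
have [g [Vg Dg Bg gP]] :=
  orbit_converges Hc ip (rescaled_C0 VT T_C0) A_dense V_gen B_neg B_sym f.
suff -> : P f = g by under eq_fun do rewrite -mulrN.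
have ker h : op_eigenspace A s%:C h -> rdot dot (g - P f) h = 0.
  move=> Eh; have [Dh Ah] := Eh; have [_ /(_ h Eh) Ph] := P_proj f.
  have : rdot dot (f - g) h = 0 by apply: gP => //; rewrite /B Ah subrr.
  have : rdot dot (f - P f) h = 0 by rewrite /rdot Ph.
  rewrite !(rdotBl ip); lra.
have Eg : op_eigenspace A s%:C g by split=> //; apply/eqP; rewrite -subr_eq0 -Bg.
apply/esym/eqP; rewrite -subr_eq0; apply/eqP/rnorm0_eq0/eqP.
rewrite -sqrf_eq0 -(rdotxx ip) (rdotBr ip) (ker _ Eg) ker ?subrr//.
by have [] := P_proj f.
Qed.

(** * The scalar product of square integrable functions *)

Section scalar_product.
Context d (X : measurableType d) (R : realType).
Variable mu : {measure set X -> \bar R}.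
Implicit Types f g h : X -> R[i].

Lemma integral_normc2 f : square_integrable mu f ->
  (\int[mu]_x (normc (f x) ^+ 2)%:E = (L2seminorm mu f ^+ 2)%:E)%E.
Proof.
move=> sf; rewrite -(@powR_mulrn _ (L2seminorm mu f) 2) ?fine_ge0 ?Lnorm_ge0//.
rewrite -poweR_EFin L2seminormE// poweR_Lnorm//; apply: eq_integral => x _ /=.
by rewrite -powR_mulrn ?normc_ge0// ger0_norm ?normc_ge0.
Qed.

Lemma integrable_normc2 f : square_integrable mu f ->
  mu.-integrable setT (fun x => (normc (f x) ^+ 2)%:E).
Proof.
move=> sf; have [mr mi _] := sf; apply/integrableP; split.
  by apply/measurable_EFinP/measurable_funX; exact: measurable_normc.
under eq_integral do rewrite gee0_abs ?lee_fin ?sqr_ge0//.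
by rewrite integral_normc2// ltry.
Qed.

Lemma normc_Re_Im (z : R[i]) :
  `|complex.Re z| <= normc z /\ `|complex.Im z| <= normc z.
Proof.
case: z => a b /=; split; rewrite -sqrtr_sqr ler_sqrt ?addr_ge0 ?sqr_ge0//.
  by rewrite lerDl sqr_ge0.
by rewrite lerDr sqr_ge0.
Qed.

(** The product of two square integrable functions is dominated by the sum of their
   squared moduli. *)
Lemma integrable_mul_conj f g :
  square_integrable mu f -> square_integrable mu g ->
  mu.-integrable setT (EFin \o (fun x => complex.Re (f x * (g x)^*))) /\
  mu.-integrable setT (EFin \o (fun x => complex.Im (f x * (g x)^*))).
Proof.
move=> sf sg; have [fr fi _] := sf; have [gr gi _] := sg.
have fg := integrableD measurableT (integrable_normc2 sf) (integrable_normc2 sg).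
have bound x : normc (f x * (g x)^*) <= `|normc (f x) ^+ 2 + normc (g x) ^+ 2|.
  have -> : normc (f x * (g x)^*) = normc (f x) * normc (g x).
    by rewrite normcM; case: (g x) => a b /=; rewrite sqrrN.
  rewrite ger0_norm ?addr_ge0 ?sqr_ge0//.
  have := sqr_ge0 (normc (f x) - normc (g x)).
  by have := sqr_ge0 (normc (f x) + normc (g x)); nra.
split; apply: (le_integrable measurableT _ _ fg) => [|x _].
- apply/measurable_EFinP; rewrite (_ : (fun _ => _) = fun x =>
     complex.Re (f x) * complex.Re (g x) + complex.Im (f x) * complex.Im (g x)).
    by apply: measurable_funD; exact: measurable_funM.
  by apply/funext => x; case: (f x) (g x) => ? ? [? ?] /=; ring.
- by rewrite lee_fin (le_trans (normc_Re_Im _).1).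
- apply/measurable_EFinP; rewrite (_ : (fun _ => _) = fun x =>
     complex.Im (f x) * complex.Re (g x) - complex.Re (f x) * complex.Im (g x)).
    by apply: measurable_funB; exact: measurable_funM.
  by apply/funext => x; case: (f x) (g x) => ? ? [? ?] /=; ring.
- by rewrite lee_fin (le_trans (normc_Re_Im _).2).
Qed.

(** The formula of the scalar product on functions rather than classes: linearity can
   be proved here pointwise, without passing through chosen representatives. *)
Definition sqint_dot f g : R[i] :=
  (\int[mu]_x complex.Re (f x * (g x)^*)) +i*
  (\int[mu]_x complex.Im (f x * (g x)^*)).

Lemma L2_dot_pi (f g : sqint_fun mu) :
  L2_dot (\pi_(L2 mu) f) (\pi_(L2 mu) g) = sqint_dot (\val f) (\val g).
Proof.
have [/integrableP[Re_m _] /integrableP[Im_m _]] :=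
  integrable_mul_conj (sqint_funP f) (sqint_funP g).
have [/integrableP[Re_m' _] /integrableP[Im_m' _]] :=
  integrable_mul_conj (sqint_funP (repr (\pi_(L2 mu) f)))
                      (sqint_funP (repr (\pi_(L2 mu) g))).
congr (_ +i* _); congr fine; apply: ae_eq_integral => //.
  by apply: filterS2 (L2_fun_pi f) (L2_fun_pi g) => x -> -> _.
by apply: filterS2 (L2_fun_pi f) (L2_fun_pi g) => x -> -> _.
Qed.

Lemma sqint_dot_linearl (a : R[i]) f g h k :
  square_integrable mu f -> square_integrable mu g -> square_integrable mu h ->
  (forall x, k x = a * f x + g x) ->
  sqint_dot k h = a * sqint_dot f h + sqint_dot g h.
Proof.
move=> sf sg sh kE; rewrite /sqint_dot.
have [fr fi] := integrable_mul_conj sf sh.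
have [gr gi] := integrable_mul_conj sg sh.
have iZ r u : mu.-integrable setT (EFin \o u) ->
    mu.-integrable setT (EFin \o (fun x => r * u x)).
  by move=> iu; exact: (integrableZl measurableT r iu).
have iD u v : mu.-integrable setT (EFin \o u) -> mu.-integrable setT (EFin \o v) ->
    mu.-integrable setT (EFin \o (fun x => u x + v x)).
  by move=> iu iv; exact: (integrableD measurableT iu iv).
have iB u v : mu.-integrable setT (EFin \o u) -> mu.-integrable setT (EFin \o v) ->
    mu.-integrable setT (EFin \o (fun x => u x - v x)).
  by move=> iu iv; exact: (integrableB measurableT iu iv).
case: a kE => a b kE; apply/eqP; rewrite eq_complex /=; apply/andP; split; apply/eqP.
- rewrite -(RintegralZl a measurableT fr) -(RintegralZl b measurableT fi).
  rewrite -(RintegralB measurableT (iZ _ _ fr) (iZ _ _ fi)).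
  rewrite -(RintegralD measurableT (iB _ _ (iZ _ _ fr) (iZ _ _ fi)) gr).
  apply: eq_Rintegral => x _; rewrite kE.
  by case: (f x) (g x) (h x) => ? ? [? ?] [? ?] /=; ring.
- rewrite -(RintegralZl a measurableT fi) -(RintegralZl b measurableT fr).
  rewrite -(RintegralD measurableT (iZ _ _ fi) (iZ _ _ fr)).
  rewrite -(RintegralD measurableT (iD _ _ (iZ _ _ fi) (iZ _ _ fr)) gi).
  apply: eq_Rintegral => x _; rewrite kE.
  by case: (f x) (g x) (h x) => ? ? [? ?] [? ?] /=; ring.
Qed.

Lemma sqint_dot_conj f g : square_integrable mu f -> square_integrable mu g ->
  sqint_dot g f = (sqint_dot f g)^*.
Proof.
move=> sf sg; rewrite /sqint_dot /=; congr (_ +i* _).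
  by apply: eq_Rintegral => x _; case: (f x) (g x) => ? ? [? ?] /=; ring.
have [_ fg] := integrable_mul_conj sf sg.
rewrite -mulN1r -RintegralZl//; apply: eq_Rintegral => x _.
by case: (f x) (g x) => ? ? [? ?] /=; ring.
Qed.

Lemma L2_inner_product : inner_product (@L2_dot d X R mu).
Proof.
split; last exact: L2_dot_norm.
- move=> a; elim/quotW => f; elim/quotW => g; elim/quotW => h.
  rewrite -L2_piZ -L2_piD !L2_dot_pi.
  by apply: sqint_dot_linearl; [exact: sqint_funP..|move=> x; rewrite linearP].
- elim/quotW => f; elim/quotW => g; rewrite !L2_dot_pi.
  by apply: sqint_dot_conj; exact: sqint_funP.
Qed.

End scalar_product.

(** * Completeness of the space of square integrable functions *)

Section completeness.
Context d (X : measurableType d) (R : realType).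
Variable mu : {measure set X -> \bar R}.

(** The square of the sum of the series [w], as an extended real number: squaring
   before taking the limit lets monotone convergence bound its integral. *)
Definition sq_sum_limit (w : nat -> X -> R) (x : X) : \bar R :=
  limn (fun N => ((\sum_(k < N) w k x) ^+ 2)%:E).

Section summable.
Variables (w : nat -> X -> R) (c : R).
Hypothesis w_ge0 : forall k x, 0 <= w k x.
Hypothesis w_meas : forall k, measurable_fun setT (w k).
Hypothesis w_norm : forall k, ('N[mu]_2[EFin \o w k] <= (c * 2^-1 ^+ k)%:E)%E.

Let G N x := \sum_(k < N) w k x.

Let G_meas N : measurable_fun setT (G N).
Proof. by apply: measurable_sum => k; exact: w_meas. Qed.

Let G_ge0 N x : 0 <= G N x. Proof. exact: sumr_ge0. Qed.

Let c_ge0 : 0 <= c.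
Proof.
have := le_trans (Lnorm_ge0 _ _ _) (w_norm 0).
by rewrite expr0 mulr1 lee_fin.
Qed.

Let G_norm N : ('N[mu]_2[EFin \o G N] <= (2 * c)%:E)%E.
Proof.
suff : ('N[mu]_2[EFin \o G N] <= (c * (2 - 2 * 2^-1 ^+ N))%:E)%E.
  move=> /le_trans; apply; rewrite lee_fin mulrC ler_wpM2r//.
  by rewrite lerBlDr lerDl mulr_ge0.
elim: N => [|N IH].
  rewrite expr0 mulr1 subrr mulr0 (_ : _ \o _ = cst 0%E) ?Lnorm0//.
  by apply/funext => x /=; rewrite /G big_ord0.
have -> : EFin \o G N.+1 = EFin \o (G N \+ w N)%R.
  by apply/funext => x /=; rewrite /G big_ord_recr.
apply: le_trans (eminkowski mu (G_meas N) (w_meas N) _) _; first by rewrite lee1n.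
apply: le_trans (leeD IH (w_norm N)) _.
by rewrite -EFinD lee_fin exprS; lra.
Qed.

Let G_mono x : {homo (fun N => ((G N x) ^+ 2)%:E) : n m / (n <= m)%N >-> (n <= m)%E}.
Proof.
move=> n m nm; rewrite lee_fin ler_pXn2r ?nnegrE//.
rewrite /G -!(big_mkord xpredT (fun k => w k x)) (big_cat_nat (leq0n n) nm)/= lerDl.
by apply: sumr_ge0 => k _.
Qed.

Let G2_meas N : measurable_fun setT (fun x => ((G N x) ^+ 2)%:E).
Proof. by apply/measurable_EFinP/measurable_funX; exact: G_meas. Qed.

Lemma sq_sum_limit_ge x N : (((\sum_(k < N) w k x) ^+ 2)%:E <= sq_sum_limit w x)%E.
Proof.
rewrite /sq_sum_limit (cvg_lim _ (ereal_nondecreasing_cvgn (@G_mono x)))//.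
by apply: ereal_sup_ubound; exists N.
Qed.

Lemma sq_sum_limit_ge0 x : (0 <= sq_sum_limit w x)%E.
Proof. by apply: le_trans (sq_sum_limit_ge x 0); rewrite lee_fin sqr_ge0. Qed.

Lemma measurable_sq_sum_limit : measurable_fun setT (sq_sum_limit w).
Proof.
apply: (@emeasurable_fun_cvg _ _ _ _ (fun N x => ((G N x) ^+ 2)%:E)).
  exact: G2_meas.
by move=> x _; exact: ereal_nondecreasing_is_cvgn (@G_mono x).
Qed.

(** Minkowski's inequality bounds the norm of every partial sum by the geometric sum
   [2 * c], and monotone convergence passes to the limit. *)
Lemma integral_sq_sum_limit : (\int[mu]_x sq_sum_limit w x <= ((2 * c) ^+ 2)%:E)%E.
Proof.
rewrite /sq_sum_limit monotone_convergence//; last 2 first.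
- by move=> N x _; rewrite lee_fin sqr_ge0.
- by move=> x _; exact: (@G_mono x).
apply: lime_le.
  apply: ereal_nondecreasing_is_cvgn => n m nm.
  apply: ge0_le_integral => //.
  - by move=> x _; rewrite lee_fin sqr_ge0.
  - exact: (G2_meas n).
  - exact: (G2_meas m).
  - by move=> x _; exact: (@G_mono x).
apply: nearW => N.
have -> : (\int[mu]_x ((G N x) ^+ 2)%:E = 'N[mu]_2[EFin \o G N] `^ 2)%E.
  rewrite poweR_Lnorm//; apply: eq_integral => x _ /=.
  by rewrite -powR_mulrn// ger0_norm.
rewrite -(@powR_mulrn _ (2 * c) 2) ?mulr_ge0// -poweR_EFin.
by apply: gt0_ler_poweR => //; rewrite in_itv/= leey andbT ?lee_fin ?mulr_ge0// Lnorm_ge0.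
Qed.

End summable.

Lemma cvg_bounded_variation (r : nat -> R) (b : R) :
  (forall N, \sum_(k < N) `|r k.+1 - r k| <= b) -> cvgn r.
Proof.
move=> rb.
have -> : r = (fun n => r 0%N + series (telescope r) n).
  by apply/funext => n; rewrite -eq_sum_telescope.
apply: is_cvgD; first exact: is_cvg_cst.
apply: normed_cvg; apply: nondecreasing_is_cvgn.
  by apply: nondecreasing_series => k _ _; exact: normr_ge0.
exists b => _ [N _ <-]; have := rb N.
by rewrite -(big_mkord xpredT (fun k => `|r k.+1 - r k|)).
Qed.

Lemma Lnorm2_le (h : X -> R[i]) (r : R) : 0 <= r ->
  (\int[mu]_x (normc (h x) ^+ 2)%:E <= (r ^+ 2)%:E)%E ->
  ('N[mu]_2[EFin \o (fun x => normc (h x))] <= r%:E)%E.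
Proof.
move=> r0; have -> : (\int[mu]_x (normc (h x) ^+ 2)%:E =
    'N[mu]_2[EFin \o (fun x => normc (h x))] `^ 2)%E.
  rewrite poweR_Lnorm//; apply: eq_integral => x _ /=.
  by rewrite -powR_mulrn ?normc_ge0// ger0_norm ?normc_ge0.
have := Lnorm_ge0 mu 2 (EFin \o (fun x => normc (h x))).
case: ('N[mu]_2[_])%E => [a|_|//]; last by rewrite poweRyr// leye_eq.
rewrite poweR_EFin !lee_fin => a0; rewrite powR_mulrn//.
by rewrite ler_pXn2r ?nnegrE.
Qed.

Lemma sqint_sub (f g : X -> R[i]) : square_integrable mu f -> square_integrable mu g ->
  square_integrable mu (fun x => f x - g x).
Proof.
move=> sf sg; apply/sqintP; have -> : (fun x => f x - g x) = f - g by [].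
by apply: rpredB; exact/sqintP.
Qed.

(** The Riesz-Fischer argument: the series of the moduli of the increments has finite
   square integral, so it converges almost everywhere, and then so does [F n x].
   The same series, started at [n], dominates the modulus of [f - F n]. *)
Lemma rapid_cauchy_cvg (F : nat -> X -> R[i]) :
  (forall n, square_integrable mu (F n)) ->
  (forall n, L2seminorm mu (fun x => F n.+1 x - F n x) <= 2^-1 ^+ n) ->
  exists2 f, square_integrable mu f &
    forall n, L2seminorm mu (fun x => f x - F n x) <= 2 * 2^-1 ^+ n.
Proof.
move=> sF F_rapid.
pose w n k x := normc (F (n + k)%N.+1 x - F (n + k)%N x).
have w0 n k x : 0 <= w n k x by exact: normc_ge0.
have wm n k : measurable_fun setT (w n k).
  by have [? ? _] := sqint_sub (sF (n + k)%N.+1) (sF (n + k)%N); exact: measurable_normc.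
have wN n k : ('N[mu]_2[EFin \o w n k] <= (2^-1 ^+ n * 2^-1 ^+ k)%:E)%E.
  by rewrite -L2seminormE ?lee_fin -?exprD//; exact: sqint_sub.
pose L n := sq_sum_limit (w n).
have LI n : (\int[mu]_x L n x <= ((2 * 2^-1 ^+ n) ^+ 2)%:E)%E.
  exact: integral_sq_sum_limit.
have Lm n : measurable_fun setT (L n) by exact: measurable_sq_sum_limit (wm n).
have L0 n x : (0 <= L n x)%E by exact: sq_sum_limit_ge0.
have dF n j x : normc (F (n + j)%N x - F n x) <= \sum_(k < j) w n k x.
  elim: j => [|j IH]; first by rewrite addn0 subrr big_ord0 normc0.
  rewrite big_ord_recr /=; apply: le_trans (lerD IH (lexx _)).
  apply: le_trans (le_normcD _ _).
  by rewrite addnS [in leRHS]addrC addrA subrK.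
have dL n j x : ((normc (F (n + j)%N x - F n x) ^+ 2)%:E <= L n x)%E.
  apply: le_trans (sq_sum_limit_ge (w0 n) x j).
  by rewrite lee_fin ler_pXn2r ?nnegrE ?normc_ge0// sumr_ge0.
have [N [mN N0 LN]] : {ae mu, forall x, setT x -> L 0%N x \is a fin_num}.
  apply: integrable_ae => //; apply/integrableP; split; first exact: Lm.
  under eq_integral do rewrite gee0_abs//.
  exact: le_lt_trans (LI 0%N) (ltry _).
have LE x : ~ N x -> exists b, forall j, \sum_(k < j) w 0%N k x <= b.
  move=> Nx; have Lfin : L 0%N x \is a fin_num.
    by apply: contrapT => h; apply: Nx; apply: LN => /= /(_ I).
  exists (fine (L 0%N x) + 1) => j.
  have := sq_sum_limit_ge (w0 0%N) x j; rewrite -/(L 0%N) -[X in (_ <= X)%E]fineK// lee_fin.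
  set S := \sum_(_ < _) _; move: (fine _) => b; nra.
(* The sequence is made to vanish on the null set [N] where the series of the
   moduli may diverge, so that the limit exists and is measurable everywhere. *)
pose re n x := complex.Re (F n x) * \1_(~` N) x.
pose im n x := complex.Im (F n x) * \1_(~` N) x.
have ind x : ~ N x -> \1_(~` N) x = 1 :> R by move=> Nx; rewrite indicE mem_set.
have ind0 x : N x -> \1_(~` N) x = 0 :> R.
  by move=> Nx; rewrite indicE memNset// => /(_ Nx).
have cvg_part (p : R[i] -> R) x :
    (forall z z', p z - p z' = p (z - z')) -> (forall z, `|p z| <= normc z) ->
    cvgn (fun n => p (F n x) * \1_(~` N) x).
  move=> pB pn; have [Nx|Nx] := pselect (N x).
    rewrite ind0//; under eq_fun do rewrite mulr0; exact: is_cvg_cst.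
  have [b bP] := LE x Nx; apply: (@cvg_bounded_variation _ b) => j.
  apply: le_trans (bP j); apply: ler_sum => k _.
  by rewrite ind// !mulr1 pB pn.
have re_cvg x : cvgn (fun n => re n x).
  apply: (cvg_part (@complex.Re R)); first by move=> [? ?] [].
  by move=> z; have [] := normc_Re_Im z.
have im_cvg x : cvgn (fun n => im n x).
  apply: (cvg_part (@complex.Im R)); first by move=> [? ?] [].
  by move=> z; have [] := normc_Re_Im z.
pose f x : R[i] := limn (fun n => re n x) +i* limn (fun n => im n x).
have f_re : measurable_fun setT (fun x => complex.Re (f x)).
  apply: (@measurable_fun_cvg _ _ _ _ re) => [n|x _]; last exact: re_cvg.
  have [? _ _] := sF n; apply: measurable_funM => //.
  exact/measurable_indic/measurableC.
have f_im : measurable_fun setT (fun x => complex.Im (f x)).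
  apply: (@measurable_fun_cvg _ _ _ _ im) => [n|x _]; last exact: im_cvg.
  have [_ ? _] := sF n; apply: measurable_funM => //.
  exact/measurable_indic/measurableC.
have fL n x : ~ N x -> ((normc (f x - F n x) ^+ 2)%:E <= L n x)%E.
  move=> Nx; have := L0 n x; have := dL n ^~ x.
  case: (L n x) => [b|_ _|//]; last by rewrite leey.
  move=> dLb _; rewrite lee_fin.
  have normc2 (a c : R) : normc (a +i* c) ^+ 2 = a ^+ 2 + c ^+ 2.
    by rewrite /= sqr_sqrtr// addr_ge0 ?sqr_ge0.
  have E (z z' : R[i]) : normc (z - z') ^+ 2 =
      (complex.Re z - complex.Re z') ^+ 2 + (complex.Im z - complex.Im z') ^+ 2.
    by case: z z' => ? ? [? ?]; rewrite -normc2.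
  rewrite E /=.
  pose a j := (re (j + n)%N x - complex.Re (F n x)) ^+ 2 +
              (im (j + n)%N x - complex.Im (F n x)) ^+ 2.
  have a_cvg : a j @[j --> \oo] --> (limn (fun n => re n x) - complex.Re (F n x)) ^+ 2 +
      (limn (fun n => im n x) - complex.Im (F n x)) ^+ 2.
    have cre : re (j + n)%N x @[j --> \oo] --> limn (fun n => re n x).
      by have := re_cvg x; rewrite -(cvg_shiftn n).
    have cim : im (j + n)%N x @[j --> \oo] --> limn (fun n => im n x).
      by have := im_cvg x; rewrite -(cvg_shiftn n).
    apply: cvgD; rewrite expr2; apply: cvgM; apply: cvgB => //; exact: cvg_cst.
  apply: (@cvgr_to_le _ _ _ _ a _ b a_cvg).
  apply: nearW => j; have := dLb j; rewrite lee_fin; apply: le_trans.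
  by rewrite /a /re /im ind// !mulr1 E addnC.
have d_re n : measurable_fun setT (fun x => complex.Re (f x - F n x)).
  rewrite (_ : (fun _ => _) = fun x => complex.Re (f x) - complex.Re (F n x)).
    by have [? _ _] := sF n; exact: measurable_funB.
  by apply/funext => x; case: (f x) (F n x) => ? ? [].
have d_im n : measurable_fun setT (fun x => complex.Im (f x - F n x)).
  rewrite (_ : (fun _ => _) = fun x => complex.Im (f x) - complex.Im (F n x)).
    by have [_ ? _] := sF n; exact: measurable_funB.
  by apply/funext => x; case: (f x) (F n x) => ? ? [].
have dI n : (\int[mu]_x (normc (f x - F n x)%R ^+ 2)%:E <= ((2 * 2^-1 ^+ n) ^+ 2)%:E)%E.
  apply: le_trans (LI n); apply: ae_ge0_le_integral => //.
  - by move=> x _; rewrite lee_fin sqr_ge0.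
  - apply/measurable_EFinP.
    exact: measurable_funX (measurable_normc (d_re n) (d_im n)).
  - exists N; split=> // x /= nle; apply: contrapT => Nx; apply: nle => _; exact: fL.
have dN n : ('N[mu]_2[EFin \o (fun x => normc (f x - F n x)%R)] <= (2 * 2^-1 ^+ n)%:E)%E.
  by apply: Lnorm2_le => //; rewrite mulr_ge0// exprn_ge0.
have sd n : square_integrable mu (fun x => f x - F n x).
  by split=> //; exact: le_lt_trans (dN n) (ltry _).
exists f; last by move=> n; rewrite -lee_fin L2seminormE.
have -> : f = (fun x => f x - F 0%N x) + F 0%N.
  by apply/funext => x; rewrite -[LHS](subrK (F 0%N x)).
by apply/sqintP; apply: rpredD; exact/sqintP.
Qed.

End completeness.

Section L2_space.
Context d (X : measurableType d) (R : realType).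
Variable mu : {measure set X -> \bar R}.

Lemma rnorm_L2_sub (f g : sqint_fun mu) :
  rnorm (\pi_(L2 mu) f - \pi_(L2 mu) g) = L2seminorm mu (fun x => \val f x - \val g x).
Proof.
by rewrite -L2_piN -L2_piD /rnorm L2_normE /= L2_norm_pi raddfB.
Qed.

Lemma exprV2_le n : 2^-1 ^+ n <= n.+1%:R^-1 :> R.
Proof.
by rewrite exprVn lef_pV2 ?posrE ?exprn_gt0// -natrX ler_nat ltn_expl.
Qed.

(** A Cauchy sequence has a subsequence with increments at most $2^{-n}$; by the
   Cauchy property its limit is the limit of the whole sequence. *)
Lemma L2_complete : cauchy_complete (L2 mu).
Proof.
move=> u u_cauchy.
have pow_gt0 n : 0 < 2^-1 ^+ n :> R by rewrite exprn_gt0// invr_gt0.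
have [k kP] := choice (fun n => u_cauchy _ (pow_gt0 n)).
(* Partial sums make the extracted indices nondecreasing while staying above [k]. *)
pose K n := (\sum_(i < n.+1) k i)%N.
have KS n : K n.+1 = (K n + k n.+1)%N by rewrite /K big_ord_recr.
have kK n : (k n <= K n)%N by rewrite /K big_ord_recr leq_addl.
have sub_repr (a b : L2 mu) :
    rnorm (a - b) = L2seminorm mu (fun x => L2_fun a x - L2_fun b x).
  by rewrite -rnorm_L2_sub !reprK.
have [||f sf fP] := @rapid_cauchy_cvg _ X R mu (fun n => L2_fun (u (K n))).
- by move=> n; exact: sqint_funP.
- move=> n; rewrite -sub_repr; apply: kP; last exact: kK.
  by rewrite KS (leq_trans (kK n)) ?leq_addr.
pose l : L2 mu := \pi_(L2 mu) (Sub f (introT (sqintP mu f) sf)).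
have lP n : rnorm (l - u (K n)) <= 2 * 2^-1 ^+ n.
  by rewrite -(reprK (u (K n))) rnorm_L2_sub SubK; exact: fP.
exists l; apply/cvg_rnormP => e e0.
have [n nP] := exists_natr_gt (3 / e).
exists (k n) => // p /= np.
apply: le_lt_trans (rnorm_sub_trans (u (K n)) _ _) _.
have h1 := kP n p (K n) np (kK n).
have h2 := lP n; rewrite rnormBC in h2.
have h3 : 3 * 2^-1 ^+ n < e.
  apply: le_lt_trans (ler_wpM2l _ (exprV2_le n)) _ => //.
  by rewrite ltr_pdivrMr// mulrC -ltr_pdivrMr.
lra.
Qed.

(** If $|y| \le 1$ then the excess $(|g| - 1)^+$ is at most $|g - y|$; so the excess of
   [g] has integral of its square below every $e^2$, and vanishes almost
   everywhere. *)
Lemma L2_unit_interval_closed (g : L2 mu) :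
  (forall e, 0 < e -> exists2 y, L2_unit_interval y & rnorm (g - y) < e) ->
  L2_unit_interval g.
Proof.
move=> near_g.
pose h x : R := Num.max (normc (L2_fun g x) - 1) 0.
have sg := sqint_funP (repr g); have [g_re g_im _] := sg.
have h0 x : 0 <= h x by rewrite le_max lexx orbT.
have hm : measurable_fun setT (fun x => (h x ^+ 2)%:E).
  apply/measurable_EFinP/measurable_funX; apply: measurable_maxr => //.
  by apply: measurable_funB => //; exact: measurable_normc.
have h_le (e : R) : 0 < e -> (\int[mu]_x (h x ^+ 2)%:E <= (e ^+ 2)%:E)%E.
  move=> e0; have [y y1 gy] := near_g e e0.
  have sgy := sqint_sub sg (sqint_funP (repr y)); have [gy_re gy_im _] := sgy.
  apply: (@le_trans _ _ (\int[mu]_x (normc (L2_fun g x - L2_fun y x)%R ^+ 2)%:E)%E).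
    apply: ae_ge0_le_integral => //.
    - by move=> x _; rewrite lee_fin sqr_ge0.
    - by move=> x _; rewrite lee_fin sqr_ge0.
    - apply/measurable_EFinP.
      exact: measurable_funX (measurable_normc gy_re gy_im).
    apply: filterS y1 => x /= y1 _; rewrite lee_fin ler_pXn2r ?nnegrE ?normc_ge0//.
    rewrite ge_max normc_ge0 andbT.
    have := le_normcD (L2_fun g x - L2_fun y x) (L2_fun y x); rewrite subrK.
    by move: y1; rewrite -[`|_|]/((normc _)%:C) lecR; lra.
  rewrite integral_normc2// lee_fin ler_pXn2r ?nnegrE ?(ltW e0)//.
    have <- : rnorm (g - y) = L2seminorm mu (fun x => L2_fun g x - L2_fun y x).
      by rewrite -rnorm_L2_sub !reprK.
    exact: ltW.
  by rewrite fine_ge0// Lnorm_ge0.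
have hI : (\int[mu]_x `|(h x ^+ 2)%:E| = 0)%E.
  under eq_integral do rewrite gee0_abs ?lee_fin ?sqr_ge0//.
  apply/eqP; rewrite eq_le integral_ge0 ?andbT; last first.
    by move=> x _; rewrite lee_fin sqr_ge0.
  apply/lee_addgt0Pr => e e0; rewrite add0e.
  have -> : e = Num.sqrt e ^+ 2 by rewrite sqr_sqrtr// ltW.
  by apply: h_le; rewrite sqrtr_gt0.
have := (ae_eq_integral_abs mu measurableT hm).1 hI.
apply: filterS => x /= /(_ I) [] /eqP; rewrite sqrf_eq0 => /eqP hx.
have : normc (L2_fun g x) - 1 <= h x by rewrite le_max lexx.
by rewrite hx -[`|_|]/((normc _)%:C) lecR subr_le0.
Qed.

Lemma L2_unit_interval0 : L2_unit_interval (0 : L2 mu).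
Proof.
by apply: filterS (L2_fun_pi (0 : sqint_fun mu)) => x ->; rewrite normr0 ler01.
Qed.

End L2_space.

(** * Distances, and the equivalence *)

Section distance.
Context (R : realType) (H : normedModType R[i]).
Implicit Types (x y : H) (S : set H).

Let dist_has_lbound x S : has_lbound [set complex.Re `|x - y| | y in S].
Proof. by exists 0 => _ [y _ <-]; exact: rnorm_ge0. Qed.

Lemma dist_to_le x y S : S y -> dist_to x S <= rnorm (x - y).
Proof. by move=> Sy; apply: ge_inf => //; exists y. Qed.

Lemma dist_to_ge0 x S : 0 <= dist_to x S.
Proof.
have [->|/set0P[y Sy]] := eqVneq S set0.
  by rewrite /dist_to image_set0 inf0.
apply: lb_le_inf; first by exists (rnorm (x - y)), y.
by move=> _ [z _ <-]; exact: rnorm_ge0.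
Qed.

Lemma dist_to_adherent x S e : S !=set0 -> 0 < e ->
  exists2 y, S y & rnorm (x - y) < dist_to x S + e.
Proof.
move=> [y Sy] e0; have inf_S : has_inf [set complex.Re `|x - y| | y in S].
  by split; first by exists (rnorm (x - y)), y.
by have [_ [z Sz <-] zS] := inf_adherent e0 inf_S; exists z.
Qed.

End distance.

Theorem proposition4p13 (d : measure_display) (X : measurableType d)
    (R : realType) (mu : {measure set X -> \bar R})
    (A : unbounded_operator (L2 mu)) (T : R -> {linear L2 mu -> L2 mu})
    (P : {linear L2 mu -> L2 mu})
    (A_self_adjoint : self_adjoint (@L2_dot d X R mu) A)
    (A_neg : negative_semidefinite (@L2_dot d X R mu) A)
    (A_compact : compact_resolvent A)
    (T_exp : exp_semigroup A T)
    (P_proj : orthogonal_projector (@L2_dot d X R mu)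
                (op_eigenspace A (spectral_bound A)%:C) P) :
  infty_contractive P <-> asymptotically_infty_contractive A T.
Proof.
have to_P := exp_semigroup_cvg_projector (@L2_complete _ X R mu)
  (@L2_inner_product _ X R mu) A_self_adjoint A_neg T_exp P_proj.
split=> [P_contr f f1|T_contr f f1].
  apply/cvgrPdist_lt => e e0; have /cvg_rnormP/(_ e e0) := to_P f.
  apply: filterS => t; apply: le_lt_trans.
  rewrite sub0r normrN ger0_norm ?dist_to_ge0//.
  exact/dist_to_le/P_contr.
apply: L2_unit_interval_closed => e e0.
have e30 : 0 < e / 3 by rewrite divr_gt0.
have /cvgrPdist_lt/(_ _ e30) near_I := T_contr f f1.
have /cvg_rnormP/(_ _ e30) near_P := to_P f.
have [t [tI tP]] := filter_ex (filterI near_I near_P).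
have I0 : @L2_unit_interval _ X R mu !=set0 by exists 0; exact: L2_unit_interval0.
set v := _ *: T t f in tI tP; have [y y1 vy] := dist_to_adherent v I0 e30.
exists y => //.
move: tI; rewrite sub0r normrN ger0_norm ?dist_to_ge0// => tI.
have := rnorm_sub_trans v (P f) y; rewrite (rnormBC (P f) v); lra.
Qed.
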